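(* Let $(M,\omega)$ be a compact Hermitian manifold of complex dimension $n\ge 2$, where $\omega$ is both pluriclosed and Gauduchon. Suppose that $$\Theta^{(3)}(\omega)+\Theta^{(4)}(\omega)=f\omega$$ for some $f\in C^\infty(M,\mathbb{R})$. Then the second Chern scalar curvature $S_C^{(2)}(\omega)$ is constant.
   Context: All manifolds are connected. A Hermitian metric is identified with its fundamental form $\omega=\sqrt{-1}\,h_{i\bar j}\,dz^i\wedge d\bar z^j$; $(h^{i\bar j})$ is the inverse matrix of $(h_{i\bar j})$. $\omega$ is Gauduchon if $\partial\bar\partial\omega^{n-1}=0$ and pluriclosed if $\partial\bar\partial\omega=0$. The Chern curvature of $\omega$ is $$\Theta_{i\bar jk\bar l}(\omega)=-\frac{\partial^2h_{k\bar l}}{\partial z^i\partial\bar z^j}+h^{p\bar q}\frac{\partial h_{p\bar l}}{\partial\bar z^j}\frac{\partial h_{k\bar q}}{\partial z^i}.$$ The third and fourth Chern--Ricci curvatures are $\Theta^{(3)}(\omega)=\sqrt{-1}\,\Theta^{(3)}_{i\bar j}dz^i\wedge d\bar z^j$ with $\Theta^{(3)}_{i\bar j}=h^{k\bar l}\Theta_{i\bar lk\bar j}$, and $\Theta^{(4)}(\omega)=\sqrt{-1}\,\Theta^{(4)}_{i\bar j}dz^i\wedge d\bar z^j$ with $\Theta^{(4)}_{i\bar j}=h^{k\bar l}\Theta_{k\bar ji\bar l}$. The second Chern scalar curvature is $S_C^{(2)}(\omega)=h^{i\bar l}h^{k\bar j}\Theta_{i\bar jk\bar l}(\omega)$. 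*)

(* Defs.v *)
From HB Require Import structures.
From mathcomp Require Import all_boot all_order all_algebra.
From mathcomp Require Import complex.
From mathcomp Require Import all_classical all_reals.
From mathcomp Require Import topology normedtype sequences derive.

Set Implicit Arguments.
Unset Strict Implicit.
Unset Printing Implicit Defensive.

Import Order.TTheory GRing.Theory Num.Theory.
Import numFieldNormedType.Exports.

Local Open Scope classical_set_scope.
Local Open Scope ring_scope.

(* The absolute-value topology and norm of the complex field, which the library
   attaches to its regular algebra. *)
HB.instance Definition _ (R : realType) := NormedModule.copy R[i] R[i]^o.

Section LocalCalculus.
Context {R : realType} {n : nat}.
Local Notation C := R[i].
Local Notation Cn := 'rV[R[i]]_n.
Implicit Types (f : Cn -> C) (v z : Cn) (V : set Cn).

(* Real directional derivative, for a real parameter t and a complex-valued f,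
   taken separately on the real and the imaginary part. *)
Definition reline f v z (t : R) : R := complex.Re (f (z + t%:C%C *: v)).
Definition imline f v z (t : R) : R := complex.Im (f (z + t%:C%C *: v)).

Definition rderivable f v z : Prop :=
  derivable (reline f v z) 0 1 /\ derivable (imline f v z) 0 1.

Definition rderive v f z : C :=
  Complex (derive1 (reline f v z) 0) (derive1 (imline f v z) 0).

(* Directions of the real coordinates of z^k = x^k + sqrt(-1) y^k. *)
Definition xdir (k : 'I_n) : Cn := delta_mx 0 k.
Definition ydir (k : 'I_n) : Cn := 'i%C *: delta_mx 0 k.

Definition dz (k : 'I_n) f z : C :=
  (rderive (xdir k) f z - 'i%C * rderive (ydir k) f z) / 2.
Definition dzbar (k : 'I_n) f z : C :=
  (rderive (xdir k) f z + 'i%C * rderive (ydir k) f z) / 2.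

(* C^m in the real sense on V (meant for open V): the partial derivatives of
   order at most m in the 2n real coordinates exist and are continuous. *)
Fixpoint Ck_on (m : nat) V f : Prop :=
  (forall z, V z -> {for z, continuous f}) /\
  if m is m'.+1 then
    forall k : 'I_n,
      [/\ (forall z, V z -> rderivable f (xdir k) z /\ rderivable f (ydir k) z),
          Ck_on m' V (rderive (xdir k) f) &
          Ck_on m' V (rderive (ydir k) f)]
  else True.

Definition smooth_on V f : Prop := forall m, Ck_on m V f.

(* Complex differential forms on C^n.  The generators dz^1, ..., dz^n,
   dzbar^1, ..., dzbar^n are indexed in this order by 'I_(n + n), through lshift
   and rshift.  [a S z] is the coefficient at z of the wedge product of the
   generators in S taken in increasing order. *)
Definition dform := {set 'I_(n + n)} -> Cn -> C.
Implicit Types a b : dform.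

Definition gen (j : 'I_(n + n)) : dform := fun S _ => (S == [set j]%SET)%:R.

Definition one_form : dform := fun S _ => (S == finset.set0)%:R.

(* Sign of the permutation sorting the concatenation of A and B. *)
Definition shuffle_sign (A B : {set 'I_(n + n)}) : C :=
  (-1) ^+ #|[set p in finset.setX A B | (p.2 < p.1)%N]%SET|.

Definition ext_wedge a b : dform := fun S z =>
  \sum_(A : {set 'I_(n + n)} | A \subset S)
    shuffle_sign A (S :\: A) * a A z * b (S :\: A) z.

Definition ext_pow a (m : nat) : dform := iter m (ext_wedge a) one_form.

Definition del a : dform := fun S z =>
  \sum_(k < n) ext_wedge (gen (lshift n k)) (fun T => dz k (a T)) S z.
Definition delbar a : dform := fun S z =>
  \sum_(k < n) ext_wedge (gen (rshift n k)) (fun T => dzbar k (a T)) S z.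

Definition form_add a b : dform := fun S z => a S z + b S z.
Definition form_scale f a : dform := fun S z => f z * a S z.

Definition form_eq_on V a b : Prop := forall S z, V z -> a S z = b S z.
Definition form_zero_on V a : Prop := forall S z, V z -> a S z = 0.

(* sqrt(-1) A_{i jbar} dz^i /\ dzbar^j *)
Definition form_of_mx (A : Cn -> 'M[C]_n) : dform := fun S z =>
  \sum_(i < n) \sum_(j < n)
    'i%C * A z i j * ext_wedge (gen (lshift n i)) (gen (rshift n j)) S z.

Variable h : Cn -> 'M[C]_n.

(* h^{i jbar}, with the transposition that makes
   sum_j h^{i jbar} h_{k jbar} = delta_{ik}. *)
Definition hinv z (i j : 'I_n) : C := invmx (h z) j i.

(* chern z i j k l is Theta_{i jbar k lbar} *)
Definition chern z (i j k l : 'I_n) : C :=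
  - dz i (dzbar j (fun w => h w k l)) z
  + \sum_(p < n) \sum_(q < n)
      hinv z p q * dzbar j (fun w => h w p l) z * dz i (fun w => h w k q) z.

Definition chern_ricci3 z : 'M[C]_n :=
  \matrix_(i, j) \sum_(k < n) \sum_(l < n) hinv z k l * chern z i l k j.
Definition chern_ricci4 z : 'M[C]_n :=
  \matrix_(i, j) \sum_(k < n) \sum_(l < n) hinv z k l * chern z k j i l.
Definition chern_scalar2 z : C :=
  \sum_(i < n) \sum_(j < n) \sum_(k < n) \sum_(l < n)
    hinv z i l * hinv z k j * chern z i j k l.

End LocalCalculus.

Arguments dform R n : clear implicits.

(* A homeomorphism [cmap], with inverse [cinv], from the open set [cdom] of M
   onto an open set of C^n; outside these sets the values are arbitrary. *)
Record chart (R : realType) (n : nat) (M : topologicalType) := Chart {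
  cdom : set M;
  cmap : M -> 'rV[R[i]]_n;
  cinv : 'rV[R[i]]_n -> M;
  cdom_open : open cdom;
  ccod_open : open (cmap @` cdom);
  cmap_continuous : forall x, cdom x -> {for x, continuous cmap};
  cinv_continuous : forall z, (cmap @` cdom) z -> {for z, continuous cinv};
  cmapK : forall x, cdom x -> cinv (cmap x) = x
}.

Definition ccod (R : realType) (n : nat) (M : topologicalType)
  (c : chart R n M) : set 'rV[R[i]]_n := cmap c @` cdom c.

(* The part of the codomain of c that corresponds to cdom c `&` cdom d, and the
   change of coordinates from c to d. *)
Definition overlap (R : realType) (n : nat) (M : topologicalType)
  (c d : chart R n M) : set 'rV[R[i]]_n := cmap c @` (cdom c `&` cdom d).
Definition transition (R : realType) (n : nat) (M : topologicalType)
  (c d : chart R n M) (z : 'rV[R[i]]_n) : 'rV[R[i]]_n := cmap d (cinv c z).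

(* Connected complex manifolds.  Differentiability of the transition maps is
   over the field R[i], so it is holomorphy. *)
Record complex_manifold (R : realType) (n : nat) := ComplexManifold {
  points :> topologicalType;
  points_hausdorff : hausdorff_space points;
  points_connected : connected [set: points];
  atlas : set (chart R n points);
  atlas_cover : forall x : points, exists2 c, atlas c & cdom c x;
  atlas_holomorphic : forall c d, atlas c -> atlas d ->
    forall z, overlap c d z -> differentiable (transition c d) z
}.

(* Entries h_{i jbar} of the metric in each chart.  The change of coordinates
   h_{k lbar} = d_k F^p h'_{p qbar} conj(d_l F^q) is written with the Jacobian of
   F, whose (k, p) entry is d_k F^p. *)
Record hermitian_metric (R : realType) (n : nat) (M : complex_manifold R n) :=
  HermitianMetric {
  metric_mx :> chart R n M -> 'rV[R[i]]_n -> 'M[R[i]]_n;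
  metric_smooth : forall c, atlas c ->
    forall i j, smooth_on (ccod c) (fun z => metric_mx c z i j);
  metric_herm : forall c, atlas c -> forall z, ccod c z ->
    forall i j, metric_mx c z j i = ((metric_mx c z i j)^*)%C;
  metric_pos : forall c, atlas c -> forall z, ccod c z ->
    forall v : 'rV[R[i]]_n, v != 0 ->
      0 < \sum_(i < n) \sum_(j < n) metric_mx c z i j * v 0 i * ((v 0 j)^*)%C;
  metric_compat : forall c d, atlas c -> atlas d -> forall z, overlap c d z ->
    metric_mx c z = 'J (transition c d) z *m metric_mx d (transition c d z)
                   *m (map_mx conjc ('J (transition c d) z))^T
}.

Section Geometry.
Context {R : realType} {n : nat} {M : complex_manifold R n}.
Variable omega : hermitian_metric M.

Definition fundamental_form (c : chart R n M) : dform R n :=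
  form_of_mx (omega c).

Definition Theta3 (c : chart R n M) : dform R n :=
  form_of_mx (chern_ricci3 (omega c)).
Definition Theta4 (c : chart R n M) : dform R n :=
  form_of_mx (chern_ricci4 (omega c)).

Definition pluriclosed : Prop := forall c, atlas c ->
  form_zero_on (ccod c) (del (delbar (fundamental_form c))).

Definition gauduchon : Prop := forall c, atlas c ->
  form_zero_on (ccod c)
    (del (delbar (ext_pow (fundamental_form c) n.-1))).

Definition S_C2 (c : chart R n M) (x : M) : R[i] :=
  chern_scalar2 (omega c) (cmap c x).

Definition in_chart (f : M -> R) (c : chart R n M) : 'rV[R[i]]_n -> R[i] :=
  fun z => ((f (cinv c z))%:C)%C.

Definition smooth_function (f : M -> R) : Prop := forall c, atlas c ->
  smooth_on (ccod c) (in_chart f c).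

End Geometry.

(* Main.v *)
Require Import Defs.
From mathcomp Require Import all_boot all_order all_algebra.
From mathcomp Require Import complex.
From mathcomp Require Import all_classical all_reals.
From mathcomp Require Import topology normedtype sequences derive.
From mathcomp Require Import spectral sesquilinear.
From mathcomp Require Import ring lra.

(* Proof.  Put beta_j = h^{k lbar} d_lbar h_{k jbar} and alpha_i = h^{k lbar} d_k h_{i lbar}.
   Differentiating the inverse matrix gives Theta3_{i jbar} = - d_i beta_j and
   Theta4_{i jbar} = - d_jbar alpha_i, so that i ddbar (f omega) = 0 as soon as
   Theta3 + Theta4 = f omega.  Since i ddbar omega = 0 as well, the Leibniz rule and a
   double trace turn this into
     (n - 1) h^{i jbar} d_i d_jbar f + (first order terms in f) = 0,
   an elliptic equation without zeroth order term.  By Hopf's strong maximum principle f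
   is constant on the compact connected manifold, and the trace of the hypothesis shows
   that the second Chern scalar curvature is n f / 2. *)

Set Implicit Arguments.
Unset Strict Implicit.
Unset Printing Implicit Defensive.

Import Order.TTheory GRing.Theory Num.Theory.
Import numFieldNormedType.Exports.

Local Open Scope classical_set_scope.
Local Open Scope ring_scope.

(** * Topology of C^n in real coordinates *)

(** As forms, [Theta3] and [Theta4] are, up to factors [+i] or [-i], d of a (0,1)-form and dbar of a
    (1,0)-form. Since d d = 0 and dbar dbar = 0, the operator d dbar annihilates both; in components
    this is commutation of partial derivatives. [beta] and [alpha] depend on the chart, which is
    harmless because everything before the maximum principle is local. The double trace is taken
    pointwise. It removes the term [f] times d dbar omega, and the factor [n - 1] is positive
    because [n >= 2]. The first order coefficients only have to be smooth, so they stay as the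
    contraction produces them. The shape of the development comes from derivatives being given along
    real lines only: additivity in the direction and symmetry of second derivatives must be won from
    one-variable calculus, using the continuity built into [Ck_on]. A maximum controls the complex
    Hessian one direction at a time, so the inverse metric is split into squares by the spectral
    theorem. Since [n f / 2] is obtained in every chart separately, the values of [S_C2] agree
    between charts. *)

Section Topology.
Context {R : realType}.
Local Notation C := R[i].
Local Notation Re := (@complex.Re _).
Local Notation Im := (@complex.Im _).

Lemma normc_bound (z : C) (e : R) :
  `|Re z| < e -> `|Im z| < e -> `|z| < (e + e)%:C%C.
Proof.
move=> hr hi; have -> : z = (Re z)%:C%C + 'i%C * (Im z)%:C%C.
  by case: z {hr hi} => a b; simpc.
apply: (le_lt_trans (ler_normD _ _)).
rewrite normrM normc_def /= !normc_def /= !(mulr0, mul0r, expr0n, addr0, add0r) /=.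
rewrite expr1n sqrtr1 !sqrtr_sqr -!rmorphM -rmorphD /= ltcR.
by lra.
Qed.

Lemma Re_le_normc (z : C) (e : R) : `|z| < e%:C%C -> `|Re z| < e.
Proof. by move=> h; rewrite -ltcR; apply: le_lt_trans h; exact: normc_ge_Re. Qed.

Lemma Im_le_normc (z : C) (e : R) : `|z| < e%:C%C -> `|Im z| < e.
Proof.
move=> h; have -> : Im z = - Re ('i%C * z) by case: z {h} => a b; simpc.
rewrite normrN; apply: Re_le_normc; rewrite normrM.
by rewrite [`|'i%C|]normc_def /= expr0n expr1n add0r sqrtr1 mul1r.
Qed.

(** Balls of [C] have radii in [C]. Squares with a real side form an equivalent basis of
    neighbourhoods and reduce continuity to real estimates on the two components. *)
Lemma nbhs_complexP (x : C) (P : set C) :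
  nbhs x P <->
  exists2 e : R, 0 < e & forall y, `|Re (y - x)| < e -> `|Im (y - x)| < e -> P y.
Proof.
split.
  (* The radius is a complex number; being positive in the order of [C] forces its imaginary part
     [e'] to vanish. Halving [e] pays for the bound of the modulus by the sum of the two
     components. *)
  move=> /nbhs_ballP[[e e'] /=]; rewrite ltcE /= => /andP[/eqP e'0 e0] H.
  exists (e / 2); first by rewrite divr_gt0.
  move=> y hr hi; apply: H; rewrite -ball_normE /= distrC.
  have := normc_bound hr hi; rewrite -splitr => /lt_le_trans; apply.
  by rewrite lecE /= e'0 eqxx lexx.
move=> [e e0 H]; apply/nbhs_ballP; exists e%:C%C; first by rewrite /= ltcR.
move=> y; rewrite -ball_normE /= distrC => hy.
by apply: H; [exact: Re_le_normc|exact: Im_le_normc].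
Qed.

Context {n : nat}.
Local Notation Cn := 'rV[C]_n.

Definition cube (z : Cn) (e : R) : set Cn :=
  [set y | forall i, `|Re (y 0 i - z 0 i)| < e /\ `|Im (y 0 i - z 0 i)| < e].

Lemma nbhs_cubeP (z : Cn) (P : set Cn) :
  nbhs z P <-> exists2 e : R, 0 < e & cube z e `<=` P.
Proof.
split.
  move=> /nbhs_ballP[[e e'] /=]; rewrite ltcE /= => /andP[/eqP e'0 e0] H.
  exists (e / 2); first by rewrite divr_gt0.
  move=> y hy; apply: H; split; first by rewrite ltcE /= e'0 eqxx.
  move=> i j; rewrite ord1 -ball_normE /= distrC; have [hr hi] := hy j.
  have := normc_bound hr hi; rewrite -splitr => /lt_le_trans; apply.
  by rewrite lecE /= e'0 eqxx lexx.
move=> [e e0 H]; apply/nbhs_ballP; exists e%:C%C; first by rewrite /= ltcR.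
move=> y [_ hy]; apply: H => i; have := hy 0 i.
rewrite -ball_normE /= distrC => {}hy.
by split; [exact: Re_le_normc|exact: Im_le_normc].
Qed.

Lemma Re_continuous : continuous (Re : C -> R).
Proof.
move=> x P /nbhs_ballP[e /= e0 H]; apply/nbhs_complexP; exists e => // y hr _.
by apply: H; rewrite -ball_normE /= distrC; case: x y hr => a b [c d].
Qed.

Lemma Im_continuous : continuous (Im : C -> R).
Proof.
move=> x P /nbhs_ballP[e /= e0 H]; apply/nbhs_complexP; exists e => // y _ hr.
by apply: H; rewrite -ball_normE /= distrC; case: x y hr => a b [c d].
Qed.

Lemma continuous_complex (T : topologicalType) (f : T -> C) (x : T) :
  {for x, continuous (fun y => Re (f y))} ->
  {for x, continuous (fun y => Im (f y))} -> {for x, continuous f}.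
Proof.
move=> /cvgrPdist_lt cr /cvgrPdist_lt ci P /nbhs_complexP[e e0 H].
move: (cr e e0) (ci e e0); apply: filterS2 => y.
rewrite distrC [X in _ -> X < _ -> _]distrC => hr hi; apply: H.
  by case: (f y) (f x) hr => a b [].
by case: (f y) (f x) hi => a b [].
Qed.

Lemma coord_continuous (i : 'I_n) : continuous (fun z : Cn => z 0 i).
Proof.
move=> z P /nbhs_complexP[e e0 H]; apply/nbhs_cubeP; exists e => // y hy.
by have [? ?] := hy i; apply: H.
Qed.

Lemma line_continuous (z v : Cn) : continuous (fun t : R => z + t%:C%C *: v).
Proof.
move=> t P /nbhs_cubeP[e e0 H].
(* A common bound for the coordinates of [v]; the added 1 keeps it positive when [v = 0]. Parameters
   within [e / M] then stay in the cube. *)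
have [M M0 HM] : exists2 M : R, 0 < M & forall i, `|Re (v 0 i)| < M /\ `|Im (v 0 i)| < M.
  exists (1 + \sum_i (`|Re (v 0 i)| + `|Im (v 0 i)|)).
    by rewrite ltr_wpDr// sumr_ge0// => i _; rewrite addr_ge0.
  move=> i; rewrite (bigD1 i) //=.
  have h : 0 <= \sum_(j < n | j != i) (`|Re (v 0 j)| + `|Im (v 0 j)|).
    by rewrite sumr_ge0// => j _; rewrite addr_ge0.
  have := normr_ge0 (Re (v 0 i)); have := normr_ge0 (Im (v 0 i)).
  by move=> ? ?; split; lra.
apply/nbhs_ballP; exists (e / M); first by rewrite /= divr_gt0.
move=> s; rewrite -ball_normE /= distrC ltr_pdivlMr // => hs; apply: H => i.
have -> : (z + s%:C%C *: v) 0 i - (z + t%:C%C *: v) 0 i = (s - t)%:C%C * v 0 i.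
  by rewrite !mxE rmorphB; ring.
have [hr hi] := HM i.
have -> : Re ((s - t)%:C%C * v 0 i) = (s - t) * Re (v 0 i).
  by case: (v 0 i) => a b /=; ring.
have -> : Im ((s - t)%:C%C * v 0 i) = (s - t) * Im (v 0 i).
  by case: (v 0 i) => a b /=; ring.
rewrite !normrM; split; apply: le_lt_trans hs; apply: ler_wpM2l => //; exact: ltW.
Qed.

(** Each coordinate ranges over the continuous image of a compact real square, and a finite product
    of compact sets is compact. *)
Lemma closed_cube_compact (z : Cn) (e : R) :
  compact [set y : Cn | forall i,
    `|Re (y 0 i - z 0 i)| <= e /\ `|Im (y 0 i - z 0 i)| <= e].
Proof.
pose A i := [set x : C | `|Re (x - z 0 i)| <= e /\ `|Im (x - z 0 i)| <= e].
suff cA i : compact (A i) by exact: (rV_compact cA).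
pose g (p : R * R) : C := Complex (Re (z 0 i) + p.1) (Im (z 0 i) + p.2).
have -> : A i = g @` (`[- e, e]%classic `*` `[- e, e]%classic).
  rewrite predeqE => x; split.
    case: x => a b; rewrite /A /g /=; case: (z 0 i) => c d /= [h1 h2].
    exists (a - c, b - d); first by rewrite /= !in_itv /= -!ler_norml.
    by rewrite /=; congr Complex; ring.
  move=> [[a b]]; rewrite /A /g /= !in_itv /= -!ler_norml => -[h1 h2] <-.
  case: (z 0 i) => c d /=.
  have -> : c + a - c = a by ring.
  by have -> : d + b - d = b by ring.
apply: continuous_compact; last by apply: compact_setX; exact: segment_compact.
apply: continuous_subspaceT => p; apply: continuous_complex => /=.
  by apply: cvgD; [exact: cvg_cst|exact: cvg_fst].
by apply: cvgD; [exact: cvg_cst|exact: cvg_snd].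
Qed.

End Topology.

(** * Rules for real directional derivatives of complex-valued functions *)

Section DirectionalDerivative.
Context {R : realType} {n : nat}.
Local Notation C := R[i].
Local Notation Cn := 'rV[R[i]]_n.
Local Notation Re := (@complex.Re _).
Local Notation Im := (@complex.Im _).
Implicit Types (f g : Cn -> C) (v z : Cn).

Lemma is_derive_mulr (f g : R -> R) (x a b : R) :
  is_derive x 1 f a -> is_derive x 1 g b ->
  is_derive x 1 (f * g) (f x * b + g x * a).
Proof. by move=> hf hg; exact: is_deriveM. Qed.

Lemma is_derive_affine (c d x : R) : is_derive x 1 (fun t : R => c + t * d) d.
Proof.
have h := is_deriveD (is_derive_cst c x 1)
  (is_derive_mulr (is_derive_id x 1) (is_derive_cst d x 1)).
by apply: (is_derive_eq h); rewrite mulr0 mulr1 !add0r.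
Qed.

Lemma is_derive_invr (f : R -> R) (x a : R) : f x != 0 ->
  is_derive x 1 f a -> is_derive x 1 (fun t => (f t)^-1) (- (f x) ^- 2 * a).
Proof.
move=> fx0 df; apply: DeriveDef; first exact: derivableV.
by rewrite deriveV // (@derive_val _ _ _ _ _ _ _ df).
Qed.

(** [rderive] is total and takes a meaningless value where no derivative exists. This relation
    carries existence along with the value, so that the rules below compose like those of
    [is_derive]. *)
Definition is_rderive f v z (d : C) : Prop :=
  is_derive (0 : R) 1 (reline f v z) (Re d) /\
  is_derive (0 : R) 1 (imline f v z) (Im d).

Lemma rderivableP f v z : rderivable f v z -> is_rderive f v z (rderive v f z).
Proof.
case=> hr hi; split; rewrite /rderive /= derive1E.
  exact: (derivableP hr).
exact: (derivableP hi).
Qed.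

Lemma is_rderive_rderivable f v z d : is_rderive f v z d -> rderivable f v z.
Proof. by case=> hr hi; split; apply: ex_derive. Qed.

Lemma rderive_val f v z d : is_rderive f v z d -> rderive v f z = d.
Proof.
case: d => a b [hr hi]; rewrite /rderive !derive1E.
by congr Complex; apply: derive_val.
Qed.

Lemma is_rderive_eq f v z d d' : is_rderive f v z d -> d = d' -> is_rderive f v z d'.
Proof. by move=> h <-. Qed.

Lemma near_line (z v : Cn) (P : set Cn) : nbhs z P ->
  \forall t \near (0 : R), P (z + t%:C%C *: v).
Proof.
move=> nP; have := @line_continuous R n z v 0; apply.
by rewrite scale0r addr0.
Qed.

Lemma is_rderive_near f g v z d : (\forall y \near z, f y = g y) ->
  is_rderive f v z d -> is_rderive g v z d.
Proof.
move=> /(near_line v) E [hr hi]; split.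
  by apply: near_eq_is_derive hr => //; near=> t; rewrite /reline; congr complex.Re; near: t.
by apply: near_eq_is_derive hi => //; near=> t; rewrite /imline; congr complex.Im; near: t.
Unshelve. all: by end_near. Qed.

Lemma is_rderive_cst (a : C) v z : is_rderive (fun=> a) v z 0.
Proof. by split; apply: is_derive_cst. Qed.

Lemma is_rderive_coord (i : 'I_n) v z : is_rderive (fun y => y 0 i) v z (v 0 i).
Proof.
have E (t : R) : (z + t%:C%C *: v) 0 i = z 0 i + t%:C%C * v 0 i by rewrite !mxE.
split.
  have -> : reline (fun y => y 0 i) v z = (fun t => Re (z 0 i) + t * Re (v 0 i)).
    apply/funext => t; rewrite /reline E; case: (z 0 i) (v 0 i) => a b [c d] /=.
    by rewrite mul0r subr0.
  exact: is_derive_affine.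
have -> : imline (fun y => y 0 i) v z = (fun t => Im (z 0 i) + t * Im (v 0 i)).
  apply/funext => t; rewrite /imline E; case: (z 0 i) (v 0 i) => a b [c d] /=.
  by rewrite mul0r addr0.
exact: is_derive_affine.
Qed.

Lemma is_rderive_conj f v z d :
  is_rderive f v z d -> is_rderive (fun y => (f y)^*%C) v z d^*%C.
Proof.
case=> hr hi; split.
  have -> : reline (fun y => (f y)^*%C) v z = reline f v z.
    by apply/funext => t; rewrite /reline; case: (f _).
  by case: d hr {hi}.
have -> : imline (fun y => (f y)^*%C) v z = - imline f v z.
  by apply/funext => t; rewrite /imline fctE; case: (f _).
by apply: is_derive_eq; case: d {hr hi}.
Qed.

Lemma is_rderiveD f g v z a b : is_rderive f v z a -> is_rderive g v z b ->
  is_rderive (fun y => f y + g y) v z (a + b).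
Proof.
move=> [fr fi] [gr gi]; split.
  have -> : reline (fun y => f y + g y) v z = reline f v z + reline g v z.
    by apply/funext => t; rewrite fctE /reline; case: (f _) (g _) => ? ? [].
  by apply: is_derive_eq; case: a b {fr fi gr gi} => ? ? [].
have -> : imline (fun y => f y + g y) v z = imline f v z + imline g v z.
  by apply/funext => t; rewrite fctE /imline; case: (f _) (g _) => ? ? [].
by apply: is_derive_eq; case: a b {fr fi gr gi} => ? ? [].
Qed.

Lemma is_rderiveM f g v z a b : is_rderive f v z a -> is_rderive g v z b ->
  is_rderive (fun y => f y * g y) v z (a * g z + f z * b).
Proof.
move=> [fr fi] [gr gi]; have E0 : z + (0 : R)%:C%C *: v = z by rewrite scale0r addr0.
split.
  have -> : reline (fun y => f y * g y) v z =
      reline f v z * reline g v z - imline f v z * imline g v z.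
    by apply/funext => t; rewrite !fctE /reline /imline; case: (f _) (g _) => ? ? [].
  apply: (is_derive_eq (is_deriveB (is_derive_mulr fr gr) (is_derive_mulr fi gi))).
  rewrite /reline /imline E0.
  case: a b (f z) (g z) {fr fi gr gi} => a1 a2 [b1 b2] [f1 f2] [g1 g2] /=.
  by ring.
have -> : imline (fun y => f y * g y) v z =
    reline f v z * imline g v z + imline f v z * reline g v z.
  by apply/funext => t; rewrite !fctE /reline /imline; case: (f _) (g _) => ? ? [].
apply: (is_derive_eq (is_deriveD (is_derive_mulr fr gi) (is_derive_mulr fi gr))).
rewrite /reline /imline E0.
case: a b (f z) (g z) {fr fi gr gi} => a1 a2 [b1 b2] [f1 f2] [g1 g2] /=.
by ring.
Qed.

Lemma is_rderiveV f v z d : f z != 0 -> is_rderive f v z d ->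
  is_rderive (fun y => (f y)^-1) v z (- d * (f z)^-1 * (f z)^-1).
Proof.
move=> fz0 [fr fi].
(* The inverse is conj(f) / |f|^2, and [N] is |f|^2 along the line; both components become real
   quotients. *)
pose N : R -> R := reline f v z * reline f v z + imline f v z * imline f v z.
have E0 : z + (0 : R)%:C%C *: v = z by rewrite scale0r addr0.
have NE : N 0 = Re (f z) * Re (f z) + Im (f z) * Im (f z).
  by rewrite /N !fctE /reline /imline E0.
have N0 : Re (f z) * Re (f z) + Im (f z) * Im (f z) != 0.
  move: fz0; case: (f z) => a b /=; rewrite -!expr2.
  apply: contra; rewrite paddr_eq0 ?sqr_ge0 // !sqrf_eq0 => /andP[/eqP -> /eqP ->].
  by rewrite eq_complex /= eqxx.
have dN := is_deriveD (is_derive_mulr fr fr) (is_derive_mulr fi fi).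
have N00 : N 0 != 0 by rewrite NE.
have dNV := is_derive_invr N00 dN.
have NtE t : N t = Re (f (z + t%:C%C *: v)) ^+ 2 + Im (f (z + t%:C%C *: v)) ^+ 2.
  by rewrite /N !fctE /reline /imline !expr2.
split.
  have -> : reline (fun y => (f y)^-1) v z = reline f v z * (fun t => (N t)^-1).
    by apply/funext => t; rewrite fctE NtE /reline; case: (f _).
  apply: (is_derive_eq (is_derive_mulr fr dNV)).
  rewrite -/N NE /reline /imline E0.
  case: d {fr fi dN dNV} (f z) N0 => d1 d2 [a b] /= N0.
  by field; rewrite ?expr2.
have -> : imline (fun y => (f y)^-1) v z = - (imline f v z * (fun t => (N t)^-1)).
  by apply/funext => t; rewrite !fctE NtE /imline; case: (f _).
apply: (is_derive_eq (is_deriveN (is_derive_mulr fi dNV))).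
rewrite -/N NE /reline /imline E0.
case: d {fr fi dN dNV} (f z) N0 => d1 d2 [a b] /= N0.
by field; rewrite ?expr2.
Qed.

End DirectionalDerivative.

(** * Mixed partial derivatives and directional derivatives *)

Section RealCalculus.
Context {R : realType}.
Implicit Types (p dp : R -> R) (x d : R).

(** Multiplying the difference quotient by [t] removes both the division and the exclusion of
    [t = 0]. Translations, dilations and sums of directions then become plain estimates. *)
Lemma is_derive_epsP p x d : is_derive x 1 p d <->
  forall e, 0 < e -> exists2 r, 0 < r &
    forall t, `|t| < r -> `|p (x + t) - p x - t * d| <= e * `|t|.
Proof.
have key (h : R) : h != 0 ->
    h^-1 *: ((p \o shift x) (h *: (1 : R)) - p x) = h^-1 * (p (x + h) - p x).
  by move=> _; rewrite /GRing.scale /= mulr1 [h + x]addrC.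
have keyd (d' h : R) : h != 0 ->
    `|d' - h^-1 * (p (x + h) - p x)| * `|h| = `|p (x + h) - p x - h * d'|.
  move=> h0; rewrite -normrM -normrN; congr (`|_|).
  by field.
split.
  move=> [dp <-] e e0; have := dp; rewrite -/(derivable p x 1) => /cvgrPdist_le.
  move=> /(_ e e0) /nbhs_ballP[r /= r0 H]; exists r => // t tr.
  have [->|t0] := eqVneq t 0; first by rewrite addr0 subrr mul0r subr0 normr0 mulr0.
  have := H t; rewrite -ball_normE /= sub0r normrN => /(_ tr t0).
  have q0 : 0 < `|t| by rewrite normr_gt0.
  rewrite key // => {}H.
  by rewrite -keyd // ler_pM2r.
move=> H.
have cv : h^-1 *: ((p \o shift x) (h *: (1 : R)) - p x) @[h --> 0^'] --> d.
  apply/cvgrPdist_le => e e0; have [r r0 {}H] := H e e0.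
  apply/nbhs_ballP; exists r => //= t; rewrite -ball_normE /= sub0r normrN => tr t0.
  by rewrite key // -(@ler_pM2r _ `|t|) ?normr_gt0 // keyd // H.
apply: DeriveDef; first by apply/cvg_ex; exists d.
exact/cvg_lim.
Qed.

Lemma is_derive_shiftP p x d : is_derive x 1 p d <-> is_derive (0 : R) (1 : R) (fun t => p (x + t)) d.
Proof.
split=> /is_derive_epsP H; apply/is_derive_epsP => e /H[r r0 {}H]; exists r => // t /H.
  by rewrite addr0 add0r.
by rewrite addr0 add0r.
Qed.

Lemma is_derive_dilate p d (k : R) :
  is_derive (0 : R) (1 : R) p d -> is_derive (0 : R) (1 : R) (fun t => p (k * t)) (k * d).
Proof.
have [->|k0] := eqVneq k 0.
  move=> _; rewrite mul0r; have -> : (fun t => p (0 * t)) = cst (p 0).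
    by apply/funext => t; rewrite mul0r.
  exact: is_derive_cst.
have q0 : 0 < `|k| by rewrite normr_gt0.
move=> /is_derive_epsP H; apply/is_derive_epsP => e e0.
have [r r0 {}H] := H (e / `|k|) (divr_gt0 e0 q0).
exists (r / `|k|); first exact: divr_gt0.
move=> t; rewrite ltr_pdivlMr // => tr; have := H (k * t).
rewrite normrM [`|k| * `|t|]mulrC => /(_ tr); rewrite !add0r mulr0 => h.
have -> : t * (k * d) = k * t * d by ring.
apply: (le_trans h); rewrite le_eqVlt; apply/orP; left; apply/eqP.
by field; rewrite gt_eqF.
Qed.

(** A form symmetric in the sign of [x]: of the intermediate point only its distance to 0 is kept,
    which is all that the limits below use. *)
Lemma mean_value p dp x : (forall t, `|t| <= `|x| -> is_derive t (1 : R) p (dp t)) ->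
  exists2 c, `|c| <= `|x| & p x - p 0 = dp c * x.
Proof.
move=> H.
have cont a b : (forall t, t \in `[a, b] -> `|t| <= `|x|) ->
    {within `[a, b], continuous p}.
  move=> ab; apply: derivable_within_continuous => t tab.
  by have := H t (ab t tab) => /@ex_derive.
have [x0|/ltW x0] := leP 0 x.
  have ab t : t \in `[0, x] -> `|t| <= `|x|.
    by rewrite in_itv /= => /andP[t0 tx]; rewrite !ger0_norm.
  have [c c0 E] := MVT_segment x0
    (fun t t0 => H t (ab t (subset_itv_oo_cc t0))) (cont _ _ ab).
  by exists c; [exact: ab|rewrite E subr0].
have ab t : t \in `[x, 0] -> `|t| <= `|x|.
  by rewrite in_itv /= => /andP[t0 tx]; rewrite !ler0_norm // lerN2.
have [c c0 E] := MVT_segment x0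
  (fun t t0 => H t (ab t (subset_itv_oo_cc t0))) (cont _ _ ab).
by exists c; [exact: ab|rewrite -opprB E sub0r mulrN opprK].
Qed.

Section MixedPartials.
Variables (G G1 G2 G12 G21 : R -> R -> R) (r : R).
Hypothesis r0 : 0 < r.
Hypothesis dG1 : forall s t, `|s| < r -> `|t| < r -> is_derive s (1 : R) (G ^~ t) (G1 s t).
Hypothesis dG12 : forall s t, `|s| < r -> `|t| < r -> is_derive t (1 : R) (G1 s) (G12 s t).

Lemma second_difference h : `|h| < r -> exists s t,
  [/\ `|s| <= `|h|, `|t| <= `|h| &
    G h h - G h 0 - G 0 h + G 0 0 = G12 s t * h * h].
Proof.
move=> hr; have z0 : `|0 : R| < r by rewrite normr0.
have [s sh Es] := @mean_value (fun s => G s h - G s 0) (fun s => G1 s h - G1 s 0) h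
  (fun s sh => is_deriveB (dG1 (le_lt_trans sh hr) hr) (dG1 (le_lt_trans sh hr) z0)).
have [t th Et] := @mean_value (G1 s) (G12 s) h
  (fun t th => dG12 (le_lt_trans sh hr) (le_lt_trans th hr)).
by exists s, t; split=> //; rewrite -Et -Es; ring.
Qed.

End MixedPartials.

Definition continuous_at_origin (H : R -> R -> R) := forall e, 0 < e ->
  exists2 r, 0 < r & forall s t, `|s| < r -> `|t| < r -> `|H s t - H 0 0| < e.

(** Schwarz's theorem. The second difference is symmetric in the two variables, so it is [h * h]
    times a value of [G12] and also [h * h] times a value of [G21], both taken within [h] of the
    origin. Continuity brings each value within [e / 2] of the value at the origin. *)
Lemma mixed_partials (G G1 G2 G12 G21 : R -> R -> R) (r : R) : 0 < r ->
  (forall s t, `|s| < r -> `|t| < r -> is_derive s (1 : R) (G ^~ t) (G1 s t)) ->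
  (forall s t, `|s| < r -> `|t| < r -> is_derive t (1 : R) (G s) (G2 s t)) ->
  (forall s t, `|s| < r -> `|t| < r -> is_derive t (1 : R) (G1 s) (G12 s t)) ->
  (forall s t, `|s| < r -> `|t| < r -> is_derive s (1 : R) (G2 ^~ t) (G21 s t)) ->
  continuous_at_origin G12 -> continuous_at_origin G21 -> G12 0 0 = G21 0 0.
Proof.
move=> r0 d1 d2 d12 d21 c12 c21.
apply/eqP; rewrite -subr_eq0 -normr_le0; apply/ler_addgt0Pr => e e0.
have e20 : 0 < e / 2 by rewrite divr_gt0.
have [r1 r10 H1] := c12 _ e20; have [r2 r20 H2] := c21 _ e20.
pose h := Num.min r (Num.min r1 r2) / 2.
have h0 : 0 < h by rewrite divr_gt0 // !lt_min r0 r10.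
have hlt : h < Num.min r (Num.min r1 r2).
  by rewrite /h ltr_pdivrMr // ltr_pMr ?ltr1n // !lt_min r0 r10.
move: hlt; rewrite !lt_min => /and3P[hr hr1 hr2].
have nh : `|h| = h by rewrite gtr0_norm.
have nhr : `|h| < r by rewrite nh.
have [s [t [sh th E]]] := second_difference r0 d1 d12 nhr.
have [t' [s' [th' sh' E']]] := second_difference (G := fun t s => G s t) r0
  (fun t s ht hs => d2 s t hs ht) (fun t s ht hs => d21 s t hs ht) nhr.
have EE : G12 s t = G21 s' t'.
  apply: (mulIf (lt0r_neq0 h0)); apply: (mulIf (lt0r_neq0 h0)).
  by rewrite -E -E'; ring.
have A : `|G12 s t - G12 0 0| < e / 2.
  by apply: H1; rewrite (le_lt_trans sh, le_lt_trans th) // nh.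
have B : `|G21 s' t' - G21 0 0| < e / 2.
  by apply: H2; rewrite (le_lt_trans sh', le_lt_trans th') // nh.
rewrite EE distrC in A.
have -> : G12 0 0 - G21 0 0 = (G12 0 0 - G21 s' t') + (G21 s' t' - G21 0 0) by ring.
by apply: (le_trans (ler_normD _ _)); lra.
Qed.

Lemma derivative_at_max p dp (r : R) : 0 < r ->
  (forall t, `|t| < r -> is_derive t (1 : R) p (dp t)) ->
  (forall t, `|t| < r -> p t <= p 0) -> dp 0 = 0.
Proof.
move=> r0 dpP pmax.
have H : is_derive (0 : R) (1 : R) p 0.
  apply: (@derive1_at_max _ _ (- r) r); first by lra.
  - move=> t; rewrite in_itv /= -ltr_norml => tr.
    by have := dpP t tr => /@ex_derive.
  - by rewrite in_itv /= oppr_lt0 r0.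
  - by move=> t; rewrite in_itv /= -ltr_norml => /pmax.
have H' := dpP 0; rewrite normr0 in H'; have {}H' := H' r0.
exact: (etrans (esym (@derive_val _ _ _ _ _ _ _ H')) (@derive_val _ _ _ _ _ _ _ H)).
Qed.

(** Were [d2] positive, [dp], which vanishes at 0, would be at least [c * d2 / 2] at small [c > 0],
    and the mean value theorem would make [p h] exceed [p 0]. *)
Lemma second_derivative_at_max p dp d2 (r : R) : 0 < r ->
  (forall t, `|t| < r -> is_derive t (1 : R) p (dp t)) ->
  is_derive (0 : R) (1 : R) dp d2 ->
  (forall t, `|t| < r -> p t <= p 0) -> d2 <= 0.
Proof.
move=> r0 dpP d2P pmax; rewrite leNgt; apply/negP => d2_gt0.
have dp0 := derivative_at_max r0 dpP pmax.
have /is_derive_epsP /(_ (d2 / 2)) := d2P.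
rewrite divr_gt0 // => /(_ isT) [r1 r10 H].
pose h := Num.min r r1 / 2.
have h0 : 0 < h by rewrite divr_gt0 // !lt_min r0 r10.
have hlt : h < Num.min r r1.
  by rewrite /h ltr_pdivrMr // ltr_pMr ?ltr1n // !lt_min r0 r10.
move: hlt; rewrite !lt_min => /andP[hr hr1].
have ab t : t \in `[0, h] -> `|t| < r.
  by rewrite in_itv /= => /andP[t0 th]; rewrite ger0_norm // (le_lt_trans th).
have cp : {within `[0, h], continuous p}.
  apply: derivable_within_continuous => t tab.
  by have := dpP t (ab t tab) => /@ex_derive.
have [c c0 E] := MVT h0 (fun t t0 => dpP t (ab t (subset_itv_oo_cc t0))) cp.
move: c0; rewrite in_itv /= => /andP[c0 ch].
have := H c; rewrite add0r dp0 subr0 gtr0_norm // => /(_ (lt_trans ch hr1)).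
rewrite ler_norml => /andP[Hc _].
have dc : 0 < dp c by have := mulr_gt0 c0 d2_gt0; lra.
have := pmax h; rewrite gtr0_norm // => /(_ hr).
by rewrite -subr_le0 E subr0 leNgt mulr_gt0.
Qed.

End RealCalculus.

(** * Additivity in the direction and symmetry of second derivatives *)

Section DirectionalSums.
Context {R : realType} {n : nat}.
Local Notation C := R[i].
Local Notation Cn := 'rV[R[i]]_n.
Local Notation Re := (@complex.Re _).
Local Notation Im := (@complex.Im _).
Implicit Types (f g : Cn -> C) (u v z : Cn) (V : set Cn).

Lemma is_derive_reline f v z (t : R) d : is_rderive f v (z + t%:C%C *: v) d ->
  is_derive t (1 : R) (reline f v z) (Re d) /\ is_derive t (1 : R) (imline f v z) (Im d).
Proof.
have E : forall s : R, z + t%:C%C *: v + s%:C%C *: v = z + (t + s)%:C%C *: v.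
  by move=> s; rewrite rmorphD scalerDl addrA.
move=> [hr hi]; split; apply/is_derive_shiftP.
  have <- // : reline f v (z + t%:C%C *: v) = (fun s => reline f v z (t + s)).
  by apply/funext => s; rewrite /reline E.
have <- // : imline f v (z + t%:C%C *: v) = (fun s => imline f v z (t + s)).
by apply/funext => s; rewrite /imline E.
Qed.

Lemma is_rderiveZ f v z d (k : R) :
  is_rderive f v z d -> is_rderive f (k%:C%C *: v) z (k%:C%C * d).
Proof.
have E t : t%:C%C *: (k%:C%C *: v) = (k * t)%:C%C *: v.
  by rewrite scalerA -rmorphM mulrC.
move=> [/(is_derive_dilate k) hr /(is_derive_dilate k) hi]; split.
  have -> : reline f (k%:C%C *: v) z = (fun t => reline f v z (k * t)).
    by apply/funext => t; rewrite /reline E.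
  by case: d hr {hi} => a b /=; rewrite mul0r subr0.
have -> : imline f (k%:C%C *: v) z = (fun t => imline f v z (k * t)).
  by apply/funext => t; rewrite /imline E.
by case: d hi {hr} => a b /=; rewrite mul0r addr0.
Qed.

Lemma near_plane z u v (P : set Cn) : nbhs z P -> exists2 r : R, 0 < r &
  forall s t : R, `|s| < r -> `|t| < r -> P (z + s%:C%C *: u + t%:C%C *: v).
Proof.
move=> /nbhs_cubeP[e e0 H].
have e20 : 0 < e / 2 by rewrite divr_gt0.
have cubeC : nbhs (0 : Cn) (cube 0 (e / 2)) by apply/nbhs_cubeP; exists (e / 2).
have /nbhs_ballP[r1 /= r10 H1] := near_line u cubeC.
have /nbhs_ballP[r2 /= r20 H2] := near_line v cubeC.
exists (Num.min r1 r2); first by rewrite lt_min r10.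
move=> s t; rewrite !lt_min => /andP[sr _] /andP[_ tr]; apply: H => i.
have := H1 s; rewrite -ball_normE /= sub0r normrN => /(_ sr i).
have := H2 t; rewrite -ball_normE /= sub0r normrN => /(_ tr i).
rewrite !mxE; case: (z 0 i) (s%:C%C * u 0 i) (t%:C%C * v 0 i) => a b [c d] [c' d'] /=.
rewrite !(add0r, oppr0, addr0) => -[h1 h2] [h3 h4].
have -> : a + c + c' - a = c + c' by ring.
have -> : b + d + d' - b = d + d' by ring.
by split; apply: (le_lt_trans (ler_normD _ _)); rewrite [e]splitr ltrD.
Qed.

(** The increment along [u + v] is a step along [u] followed by a step along [v]. The derivative at
    [z] controls the first; for the second, which starts at a moving point, the mean value theorem
    and the continuity of [rderive v f] at [z] are used. Each step is allowed half of [e]. *)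
Lemma is_rderive_add f u v z d (V : set Cn) : nbhs z V ->
  is_rderive f u z d -> (forall y, V y -> rderivable f v y) ->
  {for z, continuous (rderive v f)} ->
  is_rderive f (u + v) z (d + rderive v f z).
Proof.
move=> zV du dv cv.
pose P (e : R) := V `&` [set y | `|Re (rderive v f y - rderive v f z)| < e /\
  `|Im (rderive v f y - rderive v f z)| < e].
have nP e : 0 < e -> nbhs z (P e).
  move=> e0; apply: filterI => //.
  have /cv : nbhs (rderive v f z) [set y | `|Re (y - rderive v f z)| < e /\
      `|Im (y - rderive v f z)| < e] by apply/nbhs_complexP; exists e.
  exact.
have E0 : z + (0 : R)%:C%C *: (u + v) = z by rewrite scale0r addr0.
have E1 : z + (0 : R)%:C%C *: u = z by rewrite scale0r addr0.
have E2 t : z + t%:C%C *: u + t%:C%C *: v = z + t%:C%C *: (u + v).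
  by rewrite scalerDr addrA.
have E3 t : z + t%:C%C *: u + (0 : R)%:C%C *: v = z + t%:C%C *: u.
  by rewrite scale0r addr0.
case: du => /is_derive_epsP dr /is_derive_epsP di; split; apply/is_derive_epsP => e e0;
  have e20 : 0 < e / 2 by [rewrite divr_gt0]; have [r r0 H] := near_plane u v (nP _ e20).
  have [r1 r10 H1] := dr _ e20; exists (Num.min r r1); first by rewrite lt_min r0.
  move=> t; rewrite lt_min => /andP[tr tr1].
  have [c ct Ec] := @mean_value _ (reline f v (z + t%:C%C *: u))
    (fun s => Re (rderive v f (z + t%:C%C *: u + s%:C%C *: v))) t
    (fun s st => (is_derive_reline (rderivableP (dv _ (H t s tr (le_lt_trans st tr)).1))).1).
  have [_ [h _]] := H t c tr (le_lt_trans ct tr).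
  have := H1 t tr1; move: Ec; rewrite !add0r /reline E0 E1 E2 E3 => Ec {}H1.
  have -> : Re (f (z + t%:C%C *: (u + v))) - Re (f z) - t * Re (d + rderive v f z) =
     (Re (f (z + t%:C%C *: u)) - Re (f z) - t * Re d) +
     Re (rderive v f (z + t%:C%C *: u + c%:C%C *: v) - rderive v f z) * t.
    move/eqP: Ec; rewrite subr_eq => /eqP ->.
    by case: d (rderive v f z) (rderive v f _) {dr di H1 h} => ? ? [? ?] [? ?] /=; ring.
  apply: (le_trans (ler_normD _ _)).
  have -> : e * `|t| = e / 2 * `|t| + e / 2 * `|t| by field.
  by apply: lerD => //; rewrite normrM ler_wpM2r // ltW.
have [r1 r10 H1] := di _ e20; exists (Num.min r r1); first by rewrite lt_min r0.
move=> t; rewrite lt_min => /andP[tr tr1].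
have [c ct Ec] := @mean_value _ (imline f v (z + t%:C%C *: u))
  (fun s => Im (rderive v f (z + t%:C%C *: u + s%:C%C *: v))) t
  (fun s st => (is_derive_reline (rderivableP (dv _ (H t s tr (le_lt_trans st tr)).1))).2).
have [_ [_ h]] := H t c tr (le_lt_trans ct tr).
have := H1 t tr1; move: Ec; rewrite !add0r /imline E0 E1 E2 E3 => Ec {}H1.
have -> : Im (f (z + t%:C%C *: (u + v))) - Im (f z) - t * Im (d + rderive v f z) =
   (Im (f (z + t%:C%C *: u)) - Im (f z) - t * Im d) +
   Im (rderive v f (z + t%:C%C *: u + c%:C%C *: v) - rderive v f z) * t.
  move/eqP: Ec; rewrite subr_eq => /eqP ->.
  by case: d (rderive v f z) (rderive v f _) {dr di H1 h} => ? ? [? ?] [? ?] /=; ring.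
apply: (le_trans (ler_normD _ _)).
have -> : e * `|t| = e / 2 * `|t| + e / 2 * `|t| by field.
by apply: lerD => //; rewrite normrM ler_wpM2r // ltW.
Qed.

(** [mixed_partials] on the real plane through [z] spanned by [u] and [v], once for the real and
    once for the imaginary part. *)
Lemma rderive_comm f u v z V : nbhs z V ->
  (forall y, V y -> [/\ rderivable f u y, rderivable f v y,
    rderivable (rderive u f) v y & rderivable (rderive v f) u y]) ->
  {for z, continuous (rderive v (rderive u f))} ->
  {for z, continuous (rderive u (rderive v f))} ->
  rderive v (rderive u f) z = rderive u (rderive v f) z.
Proof.
move=> zV dV cuv cvu.
(* The parametrisation is kept abstract: rewriting with [qE] or [qC] selects which of the two
   parameters runs along a line. *)
have [q qE] : exists q : R -> R -> Cn, forall s t, q s t = z + s%:C%C *: u + t%:C%C *: v.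
  by exists (fun s t => z + s%:C%C *: u + t%:C%C *: v).
have q00 : q 0 0 = z by rewrite qE !scale0r !addr0.
have qC s t : q s t = z + t%:C%C *: v + s%:C%C *: u by rewrite qE addrAC.
have [r r0 H] := near_plane u v zV.
have {}H s t : `|s| < r -> `|t| < r -> V (q s t) by rewrite qE; exact: H.
have cont (g : Cn -> R) : {for z, continuous g} ->
    continuous_at_origin (fun s t => g (q s t)).
  move=> cg e e0; have /cg : nbhs (g z) [set y | `|y - g z| < e].
    by apply/nbhs_ballP; exists e => // y; rewrite -ball_normE /= distrC.
  by move=> /(near_plane u v)[r1 r10 H1]; exists r1 => // s t sr tr; rewrite q00 qE; exact: H1.
have D1 w (h : Cn -> C) : (forall y, V y -> rderivable h w y) ->
    forall y t, V (y + t%:C%C *: w) ->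
      is_derive t (1 : R) (reline h w y) (Re (rderive w h (y + t%:C%C *: w))) /\
      is_derive t (1 : R) (imline h w y) (Im (rderive w h (y + t%:C%C *: w))).
  by move=> hV y t yV; exact: is_derive_reline (rderivableP (hV _ yV)).
(* [F] stands for [Re] or [Im]; the second premise says that it commutes with derivatives along
   lines. *)
have A : forall F : C -> R, continuous F ->
   (forall w h, (forall y, V y -> rderivable h w y) ->
    forall y t, V (y + t%:C%C *: w) ->
      is_derive t (1 : R) (fun t => F (h (y + t%:C%C *: w))) (F (rderive w h (y + t%:C%C *: w)))) ->
   F (rderive v (rderive u f) z) = F (rderive u (rderive v f) z).
  move=> F cF DF.
  suff : F (rderive v (rderive u f) (q 0 0)) = F (rderive u (rderive v f) (q 0 0)).
    by rewrite q00.
  apply: (@mixed_partials _ (fun s t => F (f (q s t)))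
    (fun s t => F (rderive u f (q s t))) (fun s t => F (rderive v f (q s t)))
    (fun s t => F (rderive v (rderive u f) (q s t)))
    (fun s t => F (rderive u (rderive v f) (q s t))) r r0).
  - move=> s t sr tr; rewrite qC.
    have -> : (fun s => F (f (q s t))) = (fun s => F (f (z + t%:C%C *: v + s%:C%C *: u))).
      by apply/funext => s'; rewrite qC.
    by apply: DF; [move=> y /dV[]|rewrite -qC; exact: H].
  - move=> s t sr tr; rewrite qE.
    have -> : (fun t => F (f (q s t))) = (fun t => F (f (z + s%:C%C *: u + t%:C%C *: v))).
      by apply/funext => t'; rewrite qE.
    by apply: DF; [move=> y /dV[]|rewrite -qE; exact: H].
  - move=> s t sr tr; rewrite qE.
    have -> : (fun t => F (rderive u f (q s t))) =
        (fun t => F (rderive u f (z + s%:C%C *: u + t%:C%C *: v))).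
      by apply/funext => t'; rewrite qE.
    by apply: DF; [move=> y /dV[]|rewrite -qE; exact: H].
  - move=> s t sr tr; rewrite qC.
    have -> : (fun s => F (rderive v f (q s t))) =
        (fun s => F (rderive v f (z + t%:C%C *: v + s%:C%C *: u))).
      by apply/funext => s'; rewrite qC.
    by apply: DF; [move=> y /dV[]|rewrite -qC; exact: H].
  - have c : {for z, continuous (F \o rderive v (rderive u f))}.
      by apply: continuous_comp; [exact: cuv|exact: cF].
    exact: (cont _ c).
  - have c : {for z, continuous (F \o rderive u (rderive v f))}.
      by apply: continuous_comp; [exact: cvu|exact: cF].
    exact: (cont _ c).
have hr := A _ Re_continuous (fun w h hV y t yV => (D1 w h hV y t yV).1).
have hi := A _ Im_continuous (fun w h hV y t yV => (D1 w h hV y t yV).2).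
move: hr hi; move: (rderive v _ z) (rderive u _ z) => [a b] [c d] /=.
by move=> -> ->.
Qed.

End DirectionalSums.

(** * Smooth functions and the Wirtinger operators *)

Section SmoothFunctions.
Context {R : realType} {n : nat}.
Local Notation C := R[i].
Local Notation Cn := 'rV[R[i]]_n.
Local Notation Re := (@complex.Re _).
Local Notation Im := (@complex.Im _).
Implicit Types (f g : Cn -> C) (u v z : Cn) (V : set Cn).

(** Merges the two families of real coordinate directions, so that each induction on the order of
    smoothness has one case instead of two. *)
Inductive coordinate_dir : Cn -> Prop :=
| coordinate_xdir k : coordinate_dir (xdir k)
| coordinate_ydir k : coordinate_dir (ydir k).

Lemma Ck_onS m V f : Ck_on m.+1 V f <->
  (forall z, V z -> {for z, continuous f}) /\
  forall v, coordinate_dir v ->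
    (forall z, V z -> rderivable f v z) /\ Ck_on m V (rderive v f).
Proof.
split=> -[cf df]; (split; first exact: cf).
  move=> v [] k; have [d dx dy] := df k.
    by split; [move=> z Vz; exact: (d z Vz).1|exact: dx].
  by split; [move=> z Vz; exact: (d z Vz).2|exact: dy].
move=> k; have [dx Cx] := df _ (coordinate_xdir k).
have [dy Cy] := df _ (coordinate_ydir k).
split; [|exact: Cx|exact: Cy].
by move=> z Vz; split; [exact: dx|exact: dy].
Qed.

Lemma smooth_onP V f : smooth_on V f <->
  (forall z, V z -> {for z, continuous f}) /\
  forall v, coordinate_dir v ->
    (forall z, V z -> rderivable f v z) /\ smooth_on V (rderive v f).
Proof.
split.
  move=> sf; split; first exact: (sf 0%N).1.
  move=> v cv; split; first exact: (((Ck_onS 0 V f).1 (sf 1%N)).2 v cv).1.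
  by move=> m; exact: (((Ck_onS m V f).1 (sf m.+1)).2 v cv).2.
move=> [cf df] [|m]; first by split; [exact: cf|].
apply/Ck_onS; split; first exact: cf.
by move=> v /df[d s]; split; [exact: d|exact: s].
Qed.

Lemma open_near_eq V f g z : open V -> V z -> (forall y, V y -> f y = g y) ->
  \forall y \near z, f y = g y.
Proof.
move=> oV Vz E; have : nbhs z V by exact: open_nbhs_nbhs.
by apply: filterS => y /E.
Qed.

(** Since [V] is open, equality on [V] is equality near each of its points, and continuity and
    derivatives depend on nothing else. *)
Lemma Ck_on_ext m V f g : open V -> (forall z, V z -> f z = g z) ->
  Ck_on m V f -> Ck_on m V g.
Proof.
move=> oV; have cont (h k : Cn -> C) : (forall z, V z -> h z = k z) ->
    (forall z, V z -> {for z, continuous h}) -> forall z, V z -> {for z, continuous k}.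
  move=> E ch z Vz P; rewrite -(E z Vz) => /(ch z Vz).
  by apply: filterS2 (open_near_eq oV Vz E) => y /= <-.
elim: m f g => [|m IH] f g E.
  by move=> [cf _]; split; [exact: cont E cf|].
move=> /Ck_onS[cf df]; apply/Ck_onS; split; first exact: cont E cf.
move=> v cv.
have [dv Cv] := df v cv.
have dg z : V z -> is_rderive g v z (rderive v f z).
  move=> Vz; apply: is_rderive_near (rderivableP (dv z Vz)).
  exact: open_near_eq Vz E.
split; first by move=> z /dg; exact: is_rderive_rderivable.
by apply: IH Cv => z /dg/rderive_val.
Qed.

Lemma smooth_ext V f g : open V -> (forall z, V z -> f z = g z) ->
  smooth_on V f -> smooth_on V g.
Proof. by move=> oV E sf m; exact: Ck_on_ext E (sf m). Qed.

#[local] Opaque smooth_on Ck_on rderive xdir ydir.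

(* Closed under partial derivatives by the Leibniz rules, whence every member is
   smooth; this treats sums, products and inverses in a single induction. *)
Inductive smooth_expr V : (Cn -> C) -> Prop :=
| expr_smooth f : smooth_on V f -> smooth_expr V f
| expr_cst a : smooth_expr V (fun=> a)
| expr_coord i : smooth_expr V (fun z => z 0 i)
| expr_conj f : smooth_expr V f -> smooth_expr V (fun z => (f z)^*%C)
| expr_add f g : smooth_expr V f -> smooth_expr V g ->
    smooth_expr V (fun z => f z + g z)
| expr_mul f g : smooth_expr V f -> smooth_expr V g ->
    smooth_expr V (fun z => f z * g z)
| expr_inv f : (forall z, V z -> f z != 0) -> smooth_expr V f ->
    smooth_expr V (fun z => (f z)^-1).

Lemma smooth_expr_continuous V f : smooth_expr V f ->
  forall z, V z -> {for z, continuous f}.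
Proof.
elim=> [g /smooth_onP[cg _]|a|i|g _ cg|g h _ cg _ ch|g h _ cg _ ch|g g0 _ cg] z Vz.
- exact: cg.
- exact: cst_continuous.
- exact: coord_continuous.
- have cgz := cg z Vz; apply: continuous_complex.
    have -> : (fun y => Re (g y)^*%C) = (fun y => Re (g y)).
      by apply/funext => y; case: (g y).
    by apply: continuous_comp; [exact: cgz|exact: Re_continuous].
  have -> : (fun y => Im (g y)^*%C) = (fun y => - Im (g y)).
    by apply/funext => y; case: (g y).
  apply: continuousN; apply: (@continuous_comp _ _ _ g); [exact: cgz|exact: Im_continuous].
- by apply: continuousD; [exact: cg|exact: ch].
- by apply: continuousM; [exact: cg|exact: ch].
- by apply: continuousV; [exact: g0|exact: cg].
Qed.

(** The derivative is matched with an expression [g] on [V] only: outside [V] nothing is known about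
    the smooth functions from which [f] is built. *)
Lemma smooth_expr_derive V f v : coordinate_dir v -> smooth_expr V f ->
  exists2 g, smooth_expr V g & forall z, V z -> is_rderive f v z (g z).
Proof.
move=> cv; elim=> [{}f /smooth_onP[_ /(_ v cv)[df sf]]|a|i|{}f _ [f' sf' df']|
    {}f g sf [f' sf' df] sg [g' sg' dg]|
    {}f g sf [f' sf' df] sg [g' sg' dg]|{}f f0 sf [f' sf' df]].
- exists (rderive v f); first exact: expr_smooth.
  by move=> z /df; exact: rderivableP.
- by exists (fun=> 0) => [|z _]; [exact: expr_cst|exact: is_rderive_cst].
- by exists (fun=> v 0 i) => [|z _]; [exact: expr_cst|exact: is_rderive_coord].
- exists (fun z => (f' z)^*%C) => [|z /df']; first exact: expr_conj.
  exact: is_rderive_conj.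
- exists (fun z => f' z + g' z) => [|z Vz]; first exact: expr_add.
  by apply: is_rderiveD; [exact: df|exact: dg].
- exists (fun z => f' z * g z + f z * g' z) => [|z Vz].
    by apply: expr_add; apply: expr_mul.
  by apply: is_rderiveM; [exact: df|exact: dg].
(* The opposite is written as a product with -1 because [smooth_expr] has no constructor for it. *)
- exists (fun z => -1 * f' z * (f z)^-1 * (f z)^-1) => [|z Vz].
    apply: expr_mul; last exact: expr_inv.
    apply: expr_mul; last exact: expr_inv.
    by apply: expr_mul => //; exact: expr_cst.
  by rewrite mulN1r; apply: is_rderiveV; [exact: f0|exact: df].
Qed.

(** Induction on the order, for all expressions at once: a derivative of an expression is again one,
    however large it has become. *)
Lemma smooth_exprW V f : open V -> smooth_expr V f -> smooth_on V f.
Proof.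
move=> oV + m; elim: m f => [|m IH] f sf.
  by split; [exact: smooth_expr_continuous sf|].
apply/Ck_onS; split; first exact: smooth_expr_continuous sf.
move=> v cv; have [g sg dg] := smooth_expr_derive cv sf.
split; first by move=> z /dg; exact: is_rderive_rderivable.
by apply: (Ck_on_ext oV _ (IH g sg)) => z /dg/rderive_val.
Qed.

Section Closure.
Variable V : set Cn.
Hypothesis oV : open V.

Lemma smooth_continuous f z : smooth_on V f -> V z -> {for z, continuous f}.
Proof. by move=> /smooth_onP[cf _]; exact: cf. Qed.

Lemma smooth_cst (a : C) : smooth_on V (fun=> a).
Proof. by apply: smooth_exprW => //; exact: expr_cst. Qed.

Lemma smooth_coord i : smooth_on V (fun z => z 0 i).
Proof. by apply: smooth_exprW => //; exact: expr_coord. Qed.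

Lemma smooth_conj f : smooth_on V f -> smooth_on V (fun z => (f z)^*%C).
Proof. by move=> sf; apply: smooth_exprW => //; apply: expr_conj; exact: expr_smooth. Qed.

Lemma smoothD f g : smooth_on V f -> smooth_on V g -> smooth_on V (fun z => f z + g z).
Proof. by move=> sf sg; apply: smooth_exprW => //; apply: expr_add; exact: expr_smooth. Qed.

Lemma smoothM f g : smooth_on V f -> smooth_on V g -> smooth_on V (fun z => f z * g z).
Proof. by move=> sf sg; apply: smooth_exprW => //; apply: expr_mul; exact: expr_smooth. Qed.

Lemma smoothV f : (forall z, V z -> f z != 0) -> smooth_on V f ->
  smooth_on V (fun z => (f z)^-1).
Proof. by move=> f0 sf; apply: smooth_exprW => //; apply: expr_inv => //; exact: expr_smooth. Qed.

Lemma smoothN f : smooth_on V f -> smooth_on V (fun z => - f z).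
Proof.
move=> sf; apply: (smooth_ext (f := fun z => -1 * f z)) => //.
  by move=> z _; rewrite mulN1r.
by apply: smoothM => //; exact: smooth_cst.
Qed.

Lemma smoothB f g : smooth_on V f -> smooth_on V g -> smooth_on V (fun z => f z - g z).
Proof. by move=> sf sg; apply: smoothD => //; exact: smoothN. Qed.

Lemma smooth_sum (I : Type) (r : seq I) (P : pred I) (F : I -> Cn -> C) :
  (forall i, smooth_on V (F i)) -> smooth_on V (fun z => \sum_(i <- r | P i) F i z).
Proof.
move=> sF; elim: r => [|i r IH].
  by apply: (smooth_ext (f := fun=> 0)) (smooth_cst 0) => // z _; rewrite big_nil.
apply: (smooth_ext (f := fun z => (if P i then F i z else 0) + \sum_(j <- r | P j) F j z)) => //.
  by move=> z _; rewrite big_cons; case: ifP => //; rewrite add0r.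
by apply: smoothD => //; case: (P i) => //; exact: smooth_cst.
Qed.

Lemma smooth_prod (I : Type) (r : seq I) (F : I -> Cn -> C) :
  (forall i, smooth_on V (F i)) -> smooth_on V (fun z => \prod_(i <- r) F i z).
Proof.
move=> sF; elim: r => [|i r IH].
  by apply: (smooth_ext (f := fun=> 1)) (smooth_cst 1) => // z _; rewrite big_nil.
apply: (smooth_ext (f := fun z => F i z * \prod_(j <- r) F j z)) => //.
  by move=> z _; rewrite big_cons.
exact: smoothM.
Qed.

Lemma smooth_det m (A : Cn -> 'M[C]_m) : (forall i j, smooth_on V (fun z => A z i j)) ->
  smooth_on V (fun z => \det (A z)).
Proof.
move=> sA; apply: smooth_sum => s; apply: smoothM; first exact: smooth_cst.
exact: smooth_prod.
Qed.

(** Cramer's rule: the entries of the inverse are cofactors divided by the determinant. *)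
Lemma smooth_invmx m (A : Cn -> 'M[C]_m) : (forall i j, smooth_on V (fun z => A z i j)) ->
  (forall z, V z -> A z \in unitmx) ->
  forall i j, smooth_on V (fun z => invmx (A z) i j).
Proof.
move=> sA uA i j.
apply: (smooth_ext (f := fun z => (\det (A z))^-1 * cofactor (A z) j i)) => //.
  by move=> z Vz; rewrite /invmx uA // !mxE.
apply: smoothM.
  by apply: smoothV; [move=> z /uA; rewrite unitmxE unitfE|exact: smooth_det].
apply: smoothM; first exact: smooth_cst.
apply: smooth_det => k l.
apply: (smooth_ext (f := fun z => A z (lift j k) (lift i l))) => // z _.
by rewrite !mxE.
Qed.

Lemma smooth_rderive f v : coordinate_dir v -> smooth_on V f -> smooth_on V (rderive v f).
Proof. by move=> cv /smooth_onP[_ /(_ v cv)[]]. Qed.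

Lemma smooth_is_rderive f v z : coordinate_dir v -> smooth_on V f -> V z ->
  is_rderive f v z (rderive v f z).
Proof. by move=> cv /smooth_onP[_ /(_ v cv)[df _]] /df; exact: rderivableP. Qed.

End Closure.

(** The value [- 'i] of [s] gives [dz] and the value ['i] gives [dzbar], so that one proof serves
    both operators. *)
Definition wirtinger (s : C) (k : 'I_n) f z : C :=
  (rderive (xdir k) f z + s * rderive (ydir k) f z) / 2.

Lemma dzE : @dz R n = wirtinger (- 'i%C).
Proof.
by apply/funext => k; apply/funext => f; apply/funext => z; rewrite /dz /wirtinger mulNr.
Qed.

Lemma dzbarE : @dzbar R n = wirtinger 'i%C.
Proof. by []. Qed.

Section Wirtinger.
Variable V : set Cn.
Hypothesis oV : open V.
Variables (s : C) (k : 'I_n).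
Local Notation W := (wirtinger s k).

Let cx := coordinate_xdir k.
Let cy := coordinate_ydir k.

Lemma wirtinger_val f z a b : is_rderive f (xdir k) z a -> is_rderive f (ydir k) z b ->
  W f z = (a + s * b) / 2.
Proof. by move=> /rderive_val fa /rderive_val fb; rewrite /wirtinger fa fb. Qed.

Lemma smooth_wirtinger f : smooth_on V f -> smooth_on V (W f).
Proof.
move=> sf; apply: smoothM => //; last exact: smooth_cst.
apply: smoothD => //; first exact: smooth_rderive.
by apply: smoothM => //; [exact: smooth_cst|exact: smooth_rderive].
Qed.

Lemma wirtinger_ext f g z : V z -> (forall y, V y -> f y = g y) -> smooth_on V f ->
  W g z = W f z.
Proof.
move=> Vz E sf; apply: wirtinger_val; apply: is_rderive_near (smooth_is_rderive _ sf Vz) => //.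
  exact: open_near_eq Vz E.
exact: open_near_eq Vz E.
Qed.

Lemma wirtinger_cst (a : C) z : W (fun=> a) z = 0.
Proof. by rewrite (wirtinger_val (is_rderive_cst a _ z) (is_rderive_cst a _ z)) mulr0 addr0 mul0r. Qed.

Lemma wirtingerD f g z : V z -> smooth_on V f -> smooth_on V g ->
  W (fun y => f y + g y) z = W f z + W g z.
Proof.
move=> Vz sf sg; have dx h sh := @smooth_is_rderive V h _ z cx sh Vz.
have dy h sh := @smooth_is_rderive V h _ z cy sh Vz.
rewrite (wirtinger_val (is_rderiveD (dx f sf) (dx g sg)) (is_rderiveD (dy f sf) (dy g sg))).
rewrite /wirtinger.
move: (rderive (xdir k) f z) (rderive (ydir k) f z) => a b.
move: (rderive (xdir k) g z) (rderive (ydir k) g z) => c d.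
by ring.
Qed.

Lemma wirtingerM f g z : V z -> smooth_on V f -> smooth_on V g ->
  W (fun y => f y * g y) z = W f z * g z + f z * W g z.
Proof.
move=> Vz sf sg; have dx h sh := @smooth_is_rderive V h _ z cx sh Vz.
have dy h sh := @smooth_is_rderive V h _ z cy sh Vz.
rewrite (wirtinger_val (is_rderiveM (dx f sf) (dx g sg)) (is_rderiveM (dy f sf) (dy g sg))).
rewrite /wirtinger.
move: (rderive (xdir k) f z) (rderive (ydir k) f z) (f z) => a b e.
move: (rderive (xdir k) g z) (rderive (ydir k) g z) (g z) => c d e'.
by ring.
Qed.

End Wirtinger.

(** The common interface of [dz], [dzbar] and their constant combinations. The operators act on
    functions defined on all of C^n while the identities hold on [V] only, hence the law
    [der_ext]. *)
Record derivation V (D : (Cn -> C) -> Cn -> C) : Prop := Derivation {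
  der_smooth : forall f, smooth_on V f -> smooth_on V (D f);
  der_ext : forall f g z, V z -> (forall y, V y -> f y = g y) -> smooth_on V f ->
    D g z = D f z;
  der_cst : forall a z, D (fun=> a) z = 0;
  derD : forall f g z, V z -> smooth_on V f -> smooth_on V g ->
    D (fun y => f y + g y) z = D f z + D g z;
  derM : forall f g z, V z -> smooth_on V f -> smooth_on V g ->
    D (fun y => f y * g y) z = D f z * g z + f z * D g z }.

Lemma wirtinger_derivation V s k : open V -> derivation V (wirtinger s k).
Proof.
move=> oV; split.
- by move=> f; exact: smooth_wirtinger.
- by move=> f g z; exact: wirtinger_ext.
- exact: wirtinger_cst.
- by move=> f g z; exact: wirtingerD.
- by move=> f g z; exact: wirtingerM.
Qed.

Section DerivationTheory.
Variables (V : set Cn) (D : (Cn -> C) -> Cn -> C).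
Hypotheses (oV : open V) (dD : derivation V D).

Lemma derZ (a : C) f z : V z -> smooth_on V f -> D (fun y => a * f y) z = a * D f z.
Proof.
move=> Vz sf; rewrite (derM dD Vz (smooth_cst oV a) sf).
by rewrite (der_cst dD) mul0r add0r.
Qed.

Lemma derN f z : V z -> smooth_on V f -> D (fun y => - f y) z = - D f z.
Proof.
move=> Vz sf; rewrite -mulN1r -(derZ _ Vz sf); congr (D _ z).
by apply/funext => y; rewrite mulN1r.
Qed.

Lemma derB f g z : V z -> smooth_on V f -> smooth_on V g ->
  D (fun y => f y - g y) z = D f z - D g z.
Proof.
move=> Vz sf sg; rewrite (derD dD Vz sf (smoothN oV sg)).
by rewrite derN.
Qed.

Lemma der_sum (I : Type) (r : seq I) (P : pred I) (F : I -> Cn -> C) z : V z ->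
  (forall i, smooth_on V (F i)) ->
  D (fun y => \sum_(i <- r | P i) F i y) z = \sum_(i <- r | P i) D (F i) z.
Proof.
move=> Vz sF; elim: r => [|i r IH].
  rewrite big_nil -[RHS](der_cst dD 0 z); congr (D _ z).
  by apply/funext => y; rewrite big_nil.
rewrite big_cons; case: ifP => Pi.
  rewrite -IH -(derD dD Vz (sF i) (smooth_sum oV r P sF)).
  by congr (D _ z); apply/funext => y; rewrite big_cons Pi.
by rewrite -IH; congr (D _ z); apply/funext => y; rewrite big_cons Pi.
Qed.

End DerivationTheory.

Section SecondOrder.
Variables (V : set Cn) (D E : (Cn -> C) -> Cn -> C).
Hypotheses (oV : open V) (dD : derivation V D) (dE : derivation V E).

Lemma der2D f g z : V z -> smooth_on V f -> smooth_on V g ->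
  D (E (fun y => f y + g y)) z = D (E f) z + D (E g) z.
Proof.
move=> Vz sf sg; have sEf := der_smooth dE sf; have sEg := der_smooth dE sg.
rewrite -(derD dD Vz sEf sEg); apply: (der_ext dD Vz); last exact: smoothD.
by move=> y Vy; rewrite (derD dE Vy sf sg).
Qed.

Lemma der2Z (a : C) f z : V z -> smooth_on V f ->
  D (E (fun y => a * f y)) z = a * D (E f) z.
Proof.
move=> Vz sf; have sEf := der_smooth dE sf.
rewrite -(derZ oV dD a Vz sEf); apply: (der_ext dD Vz).
  by move=> y Vy; rewrite (derZ oV dE a Vy sf).
by apply: smoothM => //; exact: smooth_cst.
Qed.

Lemma der2M f g z : V z -> smooth_on V f -> smooth_on V g ->
  D (E (fun y => f y * g y)) z =
  D (E f) z * g z + E f z * D g z + D f z * E g z + f z * D (E g) z.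
Proof.
move=> Vz sf sg; have sEf := der_smooth dE sf; have sEg := der_smooth dE sg.
rewrite -[RHS]addrA -(derM dD Vz sEf sg).
have s1 := smoothM oV sEf sg; have s2 := smoothM oV sf sEg.
rewrite -(derM dD Vz sf sEg) -(derD dD Vz s1 s2); apply: (der_ext dD Vz).
  by move=> y Vy; rewrite (derM dE Vy sf sg).
exact: smoothD.
Qed.

End SecondOrder.


Lemma smooth_rderive_comm V f u v z : open V -> smooth_on V f -> V z ->
  coordinate_dir u -> coordinate_dir v ->
  rderive v (rderive u f) z = rderive u (rderive v f) z.
Proof.
move=> oV sf Vz cu cv; apply: (@rderive_comm _ _ f u v z V).
- exact: open_nbhs_nbhs.
- move=> y Vy; have d h w cw sh := is_rderive_rderivable (@smooth_is_rderive V h w y cw sh Vy).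
  by split; apply: d => //; exact: smooth_rderive.
- by apply: smooth_continuous Vz; apply: smooth_rderive => //; exact: smooth_rderive.
- by apply: smooth_continuous Vz; apply: smooth_rderive => //; exact: smooth_rderive.
Qed.

(** Both compositions expand into the same four real second derivatives, up to the order of
    differentiation. Leaving [s] and [t] free covers all pairs among [dz] and [dzbar]. *)
Lemma wirtinger_comm V f (s t : C) k l z : open V -> smooth_on V f -> V z ->
  wirtinger s k (wirtinger t l f) z = wirtinger t l (wirtinger s k f) z.
Proof.
move=> oV sf Vz.
have E (a b : C) i j : wirtinger a i (wirtinger b j f) z =
    (rderive (xdir i) (rderive (xdir j) f) z + b * rderive (xdir i) (rderive (ydir j) f) z
     + a * rderive (ydir i) (rderive (xdir j) f) z
     + a * b * rderive (ydir i) (rderive (ydir j) f) z) / 4.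
  have sx w : coordinate_dir w -> smooth_on V (rderive w f).
    by move=> cw; exact: smooth_rderive.
  have cxj := coordinate_xdir j; have cyj := coordinate_ydir j.
  have D w : coordinate_dir w -> rderive w (wirtinger b j f) z =
      (rderive w (rderive (xdir j) f) z + b * rderive w (rderive (ydir j) f) z) / 2.
    move=> cw; have dx := smooth_is_rderive cw (sx _ cxj) Vz.
    have dy := smooth_is_rderive cw (sx _ cyj) Vz.
    rewrite (rderive_val (is_rderiveM (is_rderiveD dx
      (is_rderiveM (is_rderive_cst b _ z) dy)) (is_rderive_cst 2^-1 _ z))).
    have alg (c d c' d' : C) : (c + (0 * d' + b * d)) * 2^-1 +
        (c' + b * d') * 0 = (c + b * d) / 2 by ring.
    exact: alg.
  have alg (c d c' d' : C) : ((c + b * d) / 2 + a * ((c' + b * d') / 2)) / 2 =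
    (c + b * d + a * c' + a * b * d') / 4 by field.
  have DX := D _ (coordinate_xdir i); have DY := D _ (coordinate_ydir i).
  have -> : wirtinger a i (wirtinger b j f) z = (rderive (xdir i) (wirtinger b j f) z +
    a * rderive (ydir i) (wirtinger b j f) z) / 2 by exact: erefl.
  rewrite DX DY.
  exact: alg.
have cx := coordinate_xdir; have cy := coordinate_ydir.
have C1 := smooth_rderive_comm oV sf Vz (cx l) (cx k).
have C2 := smooth_rderive_comm oV sf Vz (cy l) (cx k).
have C3 := smooth_rderive_comm oV sf Vz (cx l) (cy k).
have C4 := smooth_rderive_comm oV sf Vz (cy l) (cy k).
have alg (c d c' d' e1 e2 e3 e4 : C) : c = e1 -> d = e2 -> c' = e3 -> d' = e4 ->
    (c + t * d + s * c' + s * t * d') / 4 = (e1 + s * e3 + t * e2 + t * s * e4) / 4.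
  by move=> -> -> -> ->; ring.
by apply: etrans (E s t k l) (etrans (alg _ _ _ _ _ _ _ _ C1 C2 C3 C4) (esym (E t s l k))).
Qed.

End SmoothFunctions.

(** * The squared Euclidean distance and its balls *)

Section SquaredDistance.
Context {R : realType} {n : nat}.
Local Notation C := R[i].
Local Notation Cn := 'rV[R[i]]_n.
Local Notation Re := (@complex.Re _).
Local Notation Im := (@complex.Im _).
Implicit Types (c w z y : Cn).

(** The Euclidean distance is squared to be smooth. Two versions are kept: a complex-valued one on
    which [dz] and [dzbar] act, and a real-valued one for inequalities. *)
Definition sqdistC c z : C := \sum_(i < n) (z 0 i - c 0 i) * ((z 0 i - c 0 i)^*)%C.
Definition sqdist c z : R := Re (sqdistC c z).

Lemma Re_sum (I : Type) (r : seq I) (P : pred I) (F : I -> C) :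
  Re (\sum_(i <- r | P i) F i) = \sum_(i <- r | P i) Re (F i).
Proof. by apply: (big_morph _ _ _) => // -[? ?] [? ?]. Qed.

Lemma Im_sum (I : Type) (r : seq I) (P : pred I) (F : I -> C) :
  Im (\sum_(i <- r | P i) F i) = \sum_(i <- r | P i) Im (F i).
Proof. by apply: (big_morph _ _ _) => // -[? ?] [? ?]. Qed.

Lemma sqdistE c z :
  sqdist c z = \sum_i (Re (z 0 i - c 0 i) ^+ 2 + Im (z 0 i - c 0 i) ^+ 2).
Proof.
rewrite /sqdist Re_sum; apply: eq_bigr => i _.
by case: (z 0 i - c 0 i) => a b /=; ring.
Qed.

Lemma sqdistC_real c z : sqdistC c z = (sqdist c z)%:C%C.
Proof.
apply/eqP; rewrite eq_complex /= eqxx Im_sum; apply/eqP; apply: big1 => i _.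
by case: (z 0 i - c 0 i) => a b /=; ring.
Qed.

Lemma sqdist_ge0 c z : 0 <= sqdist c z.
Proof. by rewrite sqdistE sumr_ge0 // => i _; rewrite addr_ge0 ?sqr_ge0. Qed.

Lemma sqdist_coord c z i :
  Re (z 0 i - c 0 i) ^+ 2 <= sqdist c z /\ Im (z 0 i - c 0 i) ^+ 2 <= sqdist c z.
Proof.
rewrite sqdistE (bigD1 i) //=.
have : 0 <= \sum_(j < n | j != i) (Re (z 0 j - c 0 j) ^+ 2 + Im (z 0 j - c 0 j) ^+ 2).
  by rewrite sumr_ge0 // => j _; rewrite addr_ge0 ?sqr_ge0.
have := sqr_ge0 (Re (z 0 i - c 0 i)); have := sqr_ge0 (Im (z 0 i - c 0 i)).
by move=> ? ? ?; split; lra.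
Qed.

Lemma sqdistxx c : sqdist c c = 0.
Proof. by rewrite sqdistE big1 // => i _; rewrite subrr /= expr0n addr0. Qed.

Lemma sqdist_eq0 c z : sqdist c z = 0 -> z = c.
Proof.
move=> h; apply/rowP => i; apply/eqP; rewrite -subr_eq0.
have := sqdist_coord c z i; rewrite h; case: (z 0 i - c 0 i) => a b /= [ha hb].
have : a ^+ 2 == 0 by rewrite eq_le ha sqr_ge0.
have : b ^+ 2 == 0 by rewrite eq_le hb sqr_ge0.
by rewrite !sqrf_eq0 eq_complex /= => -> ->.
Qed.

Lemma sqdist_sym c z : sqdist c z = sqdist z c.
Proof.
rewrite !sqdistE; apply: eq_bigr => i _.
by case: (z 0 i) (c 0 i) => ? ? [? ?] /=; ring.
Qed.

(** The parallelogram law in each real coordinate: the defect of the inequality is the square of a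
    difference. *)
Lemma sqdist_triangle c z y : sqdist c y <= 2 * sqdist c z + 2 * sqdist z y.
Proof.
rewrite !sqdistE !mulr_sumr -big_split; apply: ler_sum => i _.
case: (z 0 i) (c 0 i) (y 0 i) => z1 z2 [c1 c2] [y1 y2] /=.
have := sqr_ge0 (z1 - c1 - (y1 - z1)); have := sqr_ge0 (z2 - c2 - (y2 - z2)).
by lra.
Qed.

(* A point other than w of the ball with diameter [x, w] is closer to x than w. *)
Lemma sqdist_midpoint x w z : sqdist x z =
  sqdist x w + 2 * (sqdist (2^-1 *: (x + w)) z - sqdist (2^-1 *: (x + w)) w) - sqdist w z.
Proof.
rewrite !sqdistE -sumrB mulr_sumr -big_split -sumrB; apply: eq_bigr => i _.
rewrite !mxE; have -> : (2^-1 : C) = (2^-1)%:C%C.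
  by rewrite fmorphV; congr (_^-1); rewrite -[2 in RHS]/(1 + 1) rmorphD rmorph1.
case: (z 0 i) (x 0 i) (w 0 i) => z1 z2 [x1 x2] [w1 w2] /=.
by field.
Qed.

Lemma smooth_sqdistC c V : open V -> smooth_on V (sqdistC c).
Proof.
move=> oV; apply: smooth_sum => // i.
have s : smooth_on V (fun z => z 0 i - c 0 i).
  by apply: smoothB => //; [exact: smooth_coord|exact: smooth_cst].
by apply: smoothM => //; exact: smooth_conj.
Qed.

Lemma sqdist_continuous c : continuous (sqdist c).
Proof.
move=> z; apply: continuous_comp; last exact: Re_continuous.
by apply: smooth_continuous (smooth_sqdistC c openT) _.
Qed.

Lemma nbhs_sqdist z (P : set Cn) : nbhs z P ->
  exists2 r : R, 0 < r & forall y, sqdist z y <= r -> P y.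
Proof.
move=> /nbhs_cubeP[e e0 H]; exists (e ^+ 2 / 2); first by rewrite divr_gt0 ?exprn_gt0.
move=> y hy; apply: H => i; have [h1 h2] := sqdist_coord z y i.
have e2 : e ^+ 2 / 2 < e ^+ 2 by rewrite ltr_pdivrMr // ltr_pMr ?exprn_gt0 // ltr1n.
have L (x : R) : x ^+ 2 <= sqdist z y -> `|x| < e.
  move=> hx; rewrite -(@ltr_pXn2r _ 2) // ?nnegrE ?(ltW e0) // real_normK ?num_real //.
  exact: le_lt_trans hx (le_lt_trans hy e2).
by split; exact: L.
Qed.

Lemma closed_near (K : set Cn) : (forall z, ~ K z -> \forall y \near z, ~ K y) -> closed K.
Proof. by move=> H; rewrite -openC openE => z /H. Qed.

Lemma compact_sqdist z (r : R) : compact [set y | sqdist z y <= r].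
Proof.
(* The side [1 + |r|] has square larger than [r], which avoids a square root and a discussion of the
   sign of [r]. *)
apply: (subclosed_compact _ (@closed_cube_compact R n z (1 + `|r|))).
  apply: closed_near => y /negP; rewrite -ltNge => ry.
  have : nbhs (sqdist z y) [set t | ~ (t <= r)].
    apply/nbhs_ballP; exists (sqdist z y - r); rewrite /= ?subr_gt0 // => t.
    by rewrite -ball_normE /= ltr_norml => /andP[_ ?]; apply/negP; rewrite -ltNge; lra.
  exact: sqdist_continuous.
move=> y /= hy i; have [h1 h2] := sqdist_coord z y i.
have L (x : R) : x ^+ 2 <= sqdist z y -> `|x| <= 1 + `|r|.
  move=> /le_trans /(_ hy) hx; rewrite leNgt; apply/negP => h.
  have : (1 + `|r|) ^+ 2 < `|x| ^+ 2 by rewrite ltr_pXn2r ?nnegrE ?addr_ge0.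
  rewrite real_normK ?num_real // => /lt_le_trans /(_ hx) E.
  by have := ler_norm r; have := sqr_ge0 `|r|; have := normr_ge0 r; lra.
by split; exact: L.
Qed.

End SquaredDistance.

(** * First and second derivatives in Wirtinger form at a local maximum *)

Section SecondDerivativeTest.
Context {R : realType} {n : nat}.
Local Notation C := R[i].
Local Notation Cn := 'rV[R[i]]_n.
Local Notation Re := (@complex.Re _).
Local Notation Im := (@complex.Im _).
Implicit Types (f : Cn -> C) (u v w z : Cn).
Variable V : set Cn.
Hypothesis oV : open V.

Lemma dz_derivation k : derivation V (@dz R n k).
Proof. by rewrite dzE; exact: wirtinger_derivation. Qed.

Lemma dzbar_derivation k : derivation V (@dzbar R n k).
Proof. by rewrite dzbarE; exact: wirtinger_derivation. Qed.

Lemma derivation_lin_comb (c : 'I_n -> C) (D : 'I_n -> (Cn -> C) -> Cn -> C) :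
  (forall k, derivation V (D k)) ->
  derivation V (fun f z => \sum_(k < n) c k * D k f z).
Proof.
move=> dD; split.
- move=> f sf; apply: smooth_sum => // k; apply: smoothM => //; first exact: smooth_cst.
  exact: der_smooth.
- by move=> f g z Vz E sf; apply: eq_bigr => k _; rewrite (der_ext (dD k) Vz E sf).
- by move=> a z; apply: big1 => k _; rewrite (der_cst (dD k)) mulr0.
- move=> f g z Vz sf sg; rewrite -big_split; apply: eq_bigr => k _.
  by rewrite (derD (dD k) Vz sf sg) mulrDr.
- move=> f g z Vz sf sg; rewrite mulr_suml mulr_sumr -big_split; apply: eq_bigr => k _.
  by rewrite (derM (dD k) Vz sf sg); move: (D k f z) (D k g z) => a b /=; ring.
Qed.

Lemma dz_dzbar_comm k l f z : smooth_on V f -> V z ->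
  dzbar l (dz k f) z = dz k (dzbar l f) z.
Proof. by move=> sf Vz; rewrite dzE dzbarE; exact: wirtinger_comm oV sf Vz. Qed.

Lemma dz_comm k l f z : smooth_on V f -> V z -> dz l (dz k f) z = dz k (dz l f) z.
Proof. by move=> sf Vz; rewrite dzE; exact: wirtinger_comm oV sf Vz. Qed.

Lemma dzbar_comm k l f z : smooth_on V f -> V z ->
  dzbar l (dzbar k f) z = dzbar k (dzbar l f) z.
Proof. by move=> sf Vz; rewrite dzbarE; exact: wirtinger_comm oV sf Vz. Qed.

#[local] Opaque smooth_on Ck_on rderive dz dzbar.

Lemma is_rderive0 f z : is_rderive f 0 z 0.
Proof.
split.
  have -> : reline f 0 z = cst (Re (f z)).
    by apply/funext => t; rewrite /reline scaler0 addr0.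
  exact: is_derive_cst.
have -> : imline f 0 z = cst (Im (f z)).
  by apply/funext => t; rewrite /imline scaler0 addr0.
exact: is_derive_cst.
Qed.

Lemma is_rderive_add_coordinate f u w z d (a : R) : smooth_on V f -> V z ->
  coordinate_dir w -> is_rderive f u z d ->
  is_rderive f (u + a%:C%C *: w) z (d + a%:C%C * rderive w f z).
Proof.
move=> sf Vz cw du.
have E y : V y -> is_rderive f (a%:C%C *: w) y (a%:C%C * rderive w f y).
  by move=> Vy; apply: is_rderiveZ; exact: smooth_is_rderive cw sf Vy.
rewrite -(rderive_val (E z Vz)); apply: (@is_rderive_add _ _ _ _ _ _ _ V) => //.
- exact: open_nbhs_nbhs.
- by move=> y /E; exact: is_rderive_rderivable.
have s : smooth_on V (fun y => a%:C%C * rderive w f y).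
  by apply: smoothM => //; [exact: smooth_cst|exact: smooth_rderive].
apply: smooth_continuous Vz; apply: smooth_ext s => // y Vy.
exact: esym (rderive_val (E y Vy)).
Qed.

(** The differential of [f] on the real vector [v], split into its (1,0) and (0,1) parts. *)
Definition dir_derive v f z : C := \sum_(k < n) v 0 k * dz k f z +
  \sum_(k < n) (v 0 k)^*%C * dzbar k f z.

Lemma is_rderive_dir f v z : smooth_on V f -> V z -> is_rderive f v z (dir_derive v f z).
Proof.
move=> sf Vz.
(* The direction is assembled one real coordinate at a time: [is_rderive_add] wants the added
   direction to have a continuous derivative, and smoothness gives this for coordinate
   directions. *)
have P (r : seq 'I_n) : is_rderive f
    (\sum_(k <- r) ((Re (v 0 k))%:C%C *: xdir k + (Im (v 0 k))%:C%C *: ydir k)) z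
    (\sum_(k <- r) ((Re (v 0 k))%:C%C * rderive (xdir k) f z +
                    (Im (v 0 k))%:C%C * rderive (ydir k) f z)).
  elim: r => [|k r IH]; first by rewrite !big_nil; exact: is_rderive0.
  rewrite !big_cons addrC addrA [X in is_rderive _ _ _ X]addrC addrA.
  apply: is_rderive_add_coordinate => //; first exact: coordinate_ydir.
  by apply: is_rderive_add_coordinate => //; exact: coordinate_xdir.
have vE : v = \sum_k ((Re (v 0 k))%:C%C *: xdir k + (Im (v 0 k))%:C%C *: ydir k).
  rewrite {1}[v]row_sum_delta; apply: eq_bigr => k _.
  rewrite /ydir /xdir scalerA -scalerDl; congr (_ *: _).
  by case: (v 0 k) => a b; simpc.
rewrite {1}vE; apply: is_rderive_eq (P _) _.
rewrite /dir_derive -big_split; apply: eq_bigr => k _.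
have alg (a b c d e : C) : a = e + 'i%C * d -> b = e - 'i%C * d -> forall x y : C,
    e * x + d * y = a * ((x - 'i%C * y) / 2) + b * ((x + 'i%C * y) / 2).
  move=> -> -> x y; have ii : 'i%C * 'i%C = -1 :> C by simpc.
  have -> : (e + 'i%C * d) * ((x - 'i%C * y) / 2) + (e - 'i%C * d) * ((x + 'i%C * y) / 2) =
    e * x - ('i%C * 'i%C) * (d * y) by field.
  by rewrite ii; ring.
by apply: alg; case: (v 0 k) => a b; simpc.
Qed.

Lemma dir_derive_smooth f v : smooth_on V f -> smooth_on V (dir_derive v f).
Proof.
move=> sf; apply: smoothD => //.
  exact: (der_smooth (derivation_lin_comb (fun k => v 0 k) dz_derivation)).
exact: (der_smooth (derivation_lin_comb (fun k => (v 0 k)^*%C) dzbar_derivation)).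
Qed.

(* With A = sum v_k d_k and B = sum conj(v_k) dbar_k, the real second derivatives along
   v and iv are (A + B)^2 and (iA - iB)^2, and these add up to 4 A B. *)
Lemma dir_derive_twice f v z : smooth_on V f -> V z ->
  dir_derive v (dir_derive v f) z + dir_derive ('i%C *: v) (dir_derive ('i%C *: v) f) z =
  4 * \sum_(k < n) \sum_(l < n) v 0 k * (v 0 l)^*%C * dz k (dzbar l f) z.
Proof.
move=> sf Vz.
pose A g y := \sum_(k < n) v 0 k * dz k g y.
pose B g y := \sum_(k < n) (v 0 k)^*%C * dzbar k g y.
have dA : derivation V A := derivation_lin_comb (fun k => v 0 k) dz_derivation.
have dB : derivation V B := derivation_lin_comb (fun k => (v 0 k)^*%C) dzbar_derivation.
have E1 g : dir_derive v g = (fun y => A g y + B g y) by [].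
have E2 g : dir_derive ('i%C *: v) g = (fun y => 'i%C * A g y - 'i%C * B g y).
  apply/funext => y; rewrite /dir_derive /A /B !mulr_sumr -sumrN; congr (_ + _).
    by apply: eq_bigr => k _; rewrite mxE mulrA.
  apply: eq_bigr => k _; rewrite mxE mulrA -mulNr; congr (_ * _).
  by case: (v 0 k) => a b; simpc.
have sA := der_smooth dA sf; have sB := der_smooth dB sf.
have siA : smooth_on V (fun y => 'i%C * A f y) by apply: smoothM => //; exact: smooth_cst.
have siB : smooth_on V (fun y => 'i%C * B f y) by apply: smoothM => //; exact: smooth_cst.
have AB : A (B f) z = \sum_(k < n) \sum_(l < n) v 0 k * (v 0 l)^*%C * dz k (dzbar l f) z.
  apply: eq_bigr => k _; have dk := dz_derivation k.
  have s l := der_smooth (dzbar_derivation l) sf.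
  rewrite (der_sum oV dk _ _ Vz); last first.
    by move=> l; apply: smoothM => //; exact: smooth_cst.
  by rewrite mulr_sumr; apply: eq_bigr => l _; rewrite (derZ oV dk _ Vz (s l)) mulrA.
have BA : B (A f) z = A (B f) z.
  rewrite AB exchange_big; apply: eq_bigr => l _; have dl := dzbar_derivation l.
  have s k := der_smooth (dz_derivation k) sf.
  rewrite (der_sum oV dl _ _ Vz); last first.
    by move=> k; apply: smoothM => //; exact: smooth_cst.
  rewrite mulr_sumr; apply: eq_bigr => k _; rewrite (derZ oV dl _ Vz (s k)).
  by rewrite (dz_dzbar_comm _ _ sf Vz) mulrCA mulrA.
rewrite E1 E1 E2 E2 -AB (derD dA Vz sA sB) (derD dB Vz sA sB).
rewrite (derB oV dA Vz siA siB) (derB oV dB Vz siA siB).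
rewrite !(derZ oV dA _ Vz) ?(derZ oV dB _ Vz) // BA.
have ii : 'i%C * 'i%C = -1 :> C by simpc.
move: (A (A f) z) (A (B f) z) (B (B f) z) => a b c.
have -> : 'i%C * ('i%C * a - 'i%C * b) - 'i%C * ('i%C * b - 'i%C * c) =
  ('i%C * 'i%C) * (a - b - b + c) by ring.
by rewrite ii; ring.
Qed.

Section LocalMaximum.
Variables (f : Cn -> C) (p : Cn).
Hypotheses (sf : smooth_on V f) (Vp : V p).
Hypothesis fmax : \forall y \near p, Re (f y) <= Re (f p).

Let line_max v : exists2 r : R, 0 < r & forall t : R, `|t| < r ->
  V (p + t%:C%C *: v) /\ Re (f (p + t%:C%C *: v)) <= Re (f p).
Proof.
have VP : nbhs p (V `&` [set y | Re (f y) <= Re (f p)]).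
  by apply: filterI; [exact: open_nbhs_nbhs|exact: fmax].
have /nbhs_ballP[r /= r0 H] := near_line v VP.
by exists r => // t tr; have := H t; rewrite -ball_normE /= sub0r normrN => /(_ tr)[].
Qed.

Lemma Re_rderive_at_max v : Re (dir_derive v f p) = 0.
Proof.
have [r r0 H] := line_max v.
have := @derivative_at_max R (reline f v p) (fun t => Re (dir_derive v f (p + t%:C%C *: v))) r r0.
rewrite scale0r addr0; apply.
  by move=> t /H[Vt _]; exact: (is_derive_reline (is_rderive_dir v sf Vt)).1.
by move=> t /H[_]; rewrite /reline scale0r addr0.
Qed.

Lemma Re_dir_derive_twice_at_max v : Re (dir_derive v (dir_derive v f) p) <= 0.
Proof.
have [r r0 H] := line_max v.
apply: (@second_derivative_at_max R (reline f v p) (reline (dir_derive v f) v p) _ r r0).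
- by move=> t /H[Vt _]; exact: (is_derive_reline (is_rderive_dir v sf Vt)).1.
- exact: (is_rderive_dir v (dir_derive_smooth v sf) Vp).1.
- by move=> t /H[_]; rewrite /reline scale0r addr0.
Qed.

(** By [dir_derive_twice] this is a quarter of the sum of the real second derivatives along [v] and
    ['i *: v], neither of which is positive at a maximum. *)
Lemma hessian_at_max v :
  Re (\sum_(k < n) \sum_(l < n) v 0 k * (v 0 l)^*%C * dz k (dzbar l f) p) <= 0.
Proof.
have h1 := Re_dir_derive_twice_at_max v; have h2 := Re_dir_derive_twice_at_max ('i%C *: v).
have := dir_derive_twice v sf Vp.
move: (dir_derive _ _ p) (dir_derive _ _ p) (\sum_(k < n) _) h1 h2.
move=> x y s hx hy; have -> : 4 * s = s + s + s + s by ring.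
by case: x y s hx hy => [a a'] [b b'] [c c'] /= ha hb [E _]; lra.
Qed.

End LocalMaximum.

End SecondDerivativeTest.

(** * The strong maximum principle *)

Section PositiveForms.
Context {R : realType} {n : nat}.
Local Notation C := R[i].
Local Notation Re := (@complex.Re _).
Local Notation Im := (@complex.Im _).

(* Positive definiteness of a hermitian form, in the shape in which its trace against
   a complex Hessian can be estimated direction by direction. *)
Definition sum_of_squares (A : 'M[C]_n) : Prop := exists2 Q : 'M[C]_n, Q \in unitmx &
  forall i j, A i j = \sum_(m < n) Q m i * ((Q m j)^*)%C.

Lemma sum_of_squares_trace (A Q : 'M[C]_n) (H : 'I_n -> 'I_n -> C) :
  (forall i j, A i j = \sum_(m < n) Q m i * ((Q m j)^*)%C) ->
  \sum_(i < n) \sum_(j < n) A i j * H i j =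
  \sum_(m < n) \sum_(i < n) \sum_(j < n) Q m i * ((Q m j)^*)%C * H i j.
Proof.
move=> AE; rewrite exchange_big [RHS]exchange_big /=.
rewrite exchange_big /=; apply: eq_bigr => i _; rewrite exchange_big /=.
by apply: eq_bigr => j _; rewrite AE mulr_suml.
Qed.

Lemma Re_mulC_conj (x : C) : Re (x * (x^*)%C) = Re x ^+ 2 + Im x ^+ 2.
Proof. by case: x => a b /=; ring. Qed.

(** The form is the sum of |e m|^2, where the [e m] are the coordinates of [Q] applied to conj(v);
    if all vanish, so does [v]. The conjugate sits on the first index because [dz i] of the squared
    distance is conjugated and [dzbar j] is not. *)
Lemma sum_of_squares_gt0 (A : 'M[C]_n) (v : 'rV[C]_n) : sum_of_squares A -> v != 0 ->
  0 < Re (\sum_(i < n) \sum_(j < n) A i j * (((v 0 i)^*)%C * v 0 j)).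
Proof.
move=> [Q uQ AE] v0; rewrite (sum_of_squares_trace _ AE).
pose e m := \sum_(i < n) Q m i * ((v 0 i)^*)%C.
have E m : \sum_(i < n) \sum_(j < n) Q m i * ((Q m j)^*)%C * (((v 0 i)^*)%C * v 0 j) =
    e m * ((e m)^*)%C.
  rewrite mulr_suml; apply: eq_bigr => i _; rewrite rmorph_sum mulr_sumr.
  apply: eq_bigr => j _; rewrite rmorphM /= conjcK.
  by move: (Q m i) (Q m j)^*%C (v 0 i)^*%C (v 0 j) => a b c d; ring.
rewrite (eq_bigr _ (fun m _ => E m)) Re_sum.
have ge0 m : 0 <= Re (e m * ((e m)^*)%C) by rewrite Re_mulC_conj addr_ge0 ?sqr_ge0.
rewrite lt_def sumr_ge0 // andbT; apply: contra v0 => /eqP S0.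
have e0 m : e m = 0.
  have /(_ m isT) := psumr_eq0P (fun m _ => ge0 m) S0.
  rewrite Re_mulC_conj => /eqP; rewrite paddr_eq0 ?sqr_ge0 // !sqrf_eq0.
  by case: (e m) => a b /= /andP[/eqP -> /eqP ->].
have Qv : Q *m (map_mx conjc v)^T = 0.
  by apply/matrixP => i j; rewrite ord1 !mxE -[RHS](e0 i); apply: eq_bigr => k _; rewrite !mxE.
have : (map_mx conjc v)^T = 0 by rewrite -(mulKmx uQ (map_mx conjc v)^T) Qv mulmx0.
move=> /matrixP H; apply/eqP/rowP => i; have := H i 0; rewrite !mxE => h.
by rewrite -[v 0 i]conjcK h conjc0.
Qed.

End PositiveForms.

(** * Linear second order operators with positive principal part *)

Section EllipticOperators.
Context {R : realType} {n : nat}.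
Local Notation C := R[i].
Local Notation Cn := 'rV[R[i]]_n.
Local Notation Re := (@complex.Re _).
Local Notation Im := (@complex.Im _).
Implicit Types (f g : Cn -> C) (u v w z c : Cn).

Lemma wirtinger_coord (s : C) k i z :
  wirtinger s k (fun y => y 0 i) z = (1 + s * 'i%C) / 2 *+ (i == k).
Proof.
rewrite (wirtinger_val _ (is_rderive_coord i _ z) (is_rderive_coord i _ z)).
rewrite /ydir /xdir !mxE eqxx /=; case: (i == k) => /=; last by rewrite !mulr0 addr0 mul0r.
by rewrite mulr1.
Qed.

Lemma wirtinger_conj_coord (s : C) k i z :
  wirtinger s k (fun y => (y 0 i)^*%C) z = (1 - s * 'i%C) / 2 *+ (i == k).
Proof.
rewrite (wirtinger_val _ (is_rderive_conj (is_rderive_coord i _ z))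
  (is_rderive_conj (is_rderive_coord i _ z))).
rewrite /ydir /xdir !mxE eqxx andTb; case: (i == k); last first.
  by rewrite !mulr0n mulr0 conjc0 mulr0 addr0 mul0r.
have ic : ('i%C : C)^*%C = - 'i%C by simpc.
by rewrite !mulr1n mulr1 ic conjc1 mulrN.
Qed.

Lemma dz_sqdistC c k z : dz k (sqdistC c) z = (z 0 k - c 0 k)^*%C /\
  dzbar k (sqdistC c) z = z 0 k - c 0 k.
Proof.
have oT : open (setT : set Cn) by exact: openT.
have sc i : smooth_on setT (fun y : Cn => y 0 i) by exact: smooth_coord.
have scc i : smooth_on setT (fun y : Cn => ((y 0 i)^*)%C) by exact: smooth_conj.
have E : sqdistC c = (fun z => \sum_(i < n) (z 0 i - c 0 i) * ((z 0 i)^*%C - (c 0 i)^*%C)).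
  by apply/funext => y; apply: eq_bigr => i _; rewrite rmorphB.
have sB i : smooth_on setT (fun y : Cn => y 0 i - c 0 i).
  by apply: smoothB => //; exact: smooth_cst.
have sBc i : smooth_on setT (fun y : Cn => (y 0 i)^*%C - (c 0 i)^*%C).
  by apply: smoothB => //; exact: smooth_cst.
have K (s : C) : wirtinger s k (sqdistC c) z =
    (1 + s * 'i%C) / 2 * (z 0 k - c 0 k)^*%C + (z 0 k - c 0 k) * ((1 - s * 'i%C) / 2).
  have dW := wirtinger_derivation s k oT.
  rewrite E (der_sum oT dW) //; last by move=> i; exact: smoothM.
  have T i : wirtinger s k (fun y : Cn => (y 0 i - c 0 i) * ((y 0 i)^*%C - (c 0 i)^*%C)) z =
     ((1 + s * 'i%C) / 2 * (z 0 k - c 0 k)^*%C + (z 0 k - c 0 k) * ((1 - s * 'i%C) / 2))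
     *+ (i == k).
    have h1 := smooth_cst oT (c 0 i); have h2 := smooth_cst oT ((c 0 i)^*%C).
    rewrite (derM dW I (sB i) (sBc i)) (derB oT dW I (sc i) h1) (derB oT dW I (scc i) h2).
    rewrite !(der_cst dW) !subr0 wirtinger_coord wirtinger_conj_coord.
    case: eqVneq => [->|_]; last by rewrite mul0r mulr0 addr0.
    by rewrite rmorphB.
  rewrite (eq_bigr _ (fun i _ => T i)) (bigD1 k) //= eqxx big1 ?addr0 // => i /negPf -> //.
have ii : 'i%C * 'i%C = -1 :> C by simpc.
rewrite dzE dzbarE; split; rewrite K ?mulNr ii.
  by move: (z 0 k - c 0 k) (z 0 k - c 0 k)^*%C => x y; field.
by move: (z 0 k - c 0 k) (z 0 k - c 0 k)^*%C => x y; field.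
Qed.

#[local] Opaque smooth_on Ck_on rderive dz dzbar.

Variables (V : set Cn) (a : Cn -> 'M[C]_n) (X Y : 'I_n -> Cn -> C).
Hypothesis oV : open V.
Hypothesis sa : forall i j, smooth_on V (fun z => a z i j).
Hypothesis sX : forall i, smooth_on V (X i).
Hypothesis sY : forall i, smooth_on V (Y i).
Hypothesis a_pos : forall z, V z -> sum_of_squares (a z).

(** [X] and [Y] are unrelated complex functions, so the value may fail to be real even for real [f];
    the inequalities below are therefore about its real part. *)
Definition elliptic_op f z : C :=
  \sum_(i < n) \sum_(j < n) a z i j * dz i (dzbar j f) z +
  (\sum_(i < n) X i z * dz i f z + \sum_(j < n) Y j z * dzbar j f z).

Local Notation L := elliptic_op.

Let d1 := fun k => @dz_derivation R n V oV k.
Let d2 := fun k => @dzbar_derivation R n V oV k.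

Lemma elliptic_opD f g z : V z -> smooth_on V f -> smooth_on V g ->
  L (fun y => f y + g y) z = L f z + L g z.
Proof.
move=> Vz sf sg; rewrite /elliptic_op.
have alg (x1 x2 x3 y1 y2 y3 w1 w2 w3 : C) : w1 = x1 + y1 -> w2 = x2 + y2 -> w3 = x3 + y3 ->
  w1 + (w2 + w3) = (x1 + (x2 + x3)) + (y1 + (y2 + y3)) by move=> -> -> ->; ring.
apply: alg; rewrite -big_split; apply: eq_bigr => i _.
- rewrite -big_split; apply: eq_bigr => j _.
  by rewrite (der2D oV (d1 i) (d2 j) Vz sf sg) mulrDr.
- by rewrite (derD (d1 i) Vz sf sg) mulrDr.
- by rewrite (derD (d2 i) Vz sf sg) mulrDr.
Qed.

Lemma elliptic_opZ (e : C) f z : V z -> smooth_on V f ->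
  L (fun y => e * f y) z = e * L f z.
Proof.
move=> Vz sf; rewrite /elliptic_op !mulrDr !mulr_sumr; congr (_ + (_ + _)).
- apply: eq_bigr => i _; rewrite mulr_sumr; apply: eq_bigr => j _.
  by rewrite (der2Z oV (d1 i) (d2 j) e Vz sf) mulrCA.
- by apply: eq_bigr => i _; rewrite (derZ oV (d1 i) e Vz sf) mulrCA.
- by apply: eq_bigr => i _; rewrite (derZ oV (d2 i) e Vz sf) mulrCA.
Qed.

(** Meant for a zero of [f], where only the gradient term survives; it gives the barrier its
    positive part. *)
Lemma elliptic_op_sqr f z : V z -> smooth_on V f -> L (fun y => f y * f y) z =
  2 * (f z * L f z) +
  2 * \sum_(i < n) \sum_(j < n) a z i j * (dz i f z * dzbar j f z).
Proof.
move=> Vz sf; rewrite /elliptic_op.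
have alg (b x1 x2 x3 g w1 w2 w3 : C) : w1 = 2 * b * x1 + 2 * g ->
  w2 = 2 * b * x2 -> w3 = 2 * b * x3 ->
  w1 + (w2 + w3) = 2 * (b * (x1 + (x2 + x3))) + 2 * g by move=> -> -> ->; ring.
apply: alg.
- rewrite !mulr_sumr -big_split; apply: eq_bigr => i _.
  rewrite !mulr_sumr -big_split; apply: eq_bigr => j _.
  rewrite (der2M oV (d1 i) (d2 j) Vz sf sf).
  move: (a z i j) (dz i f z) (dzbar j f z) (dz i (dzbar j f) z) (f z) => A p q r s.
  by rewrite /=; ring.
- rewrite mulr_sumr; apply: eq_bigr => i _; rewrite (derM (d1 i) Vz sf sf).
  by move: (X i z) (dz i f z) (f z) => A p q; ring.
- rewrite mulr_sumr; apply: eq_bigr => i _; rewrite (derM (d2 i) Vz sf sf).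
  by move: (Y i z) (dzbar i f z) (f z) => A p q; ring.
Qed.

Lemma smooth_elliptic_op f : smooth_on V f -> smooth_on V (L f).
Proof.
move=> sf; apply: smoothD => //; last apply: smoothD => //.
- apply: smooth_sum => // i; apply: smooth_sum => // j; apply: smoothM => //.
  exact: (der_smooth (d1 i) (der_smooth (d2 j) sf)).
- by apply: smooth_sum => // i; apply: smoothM => //; exact: (der_smooth (d1 i) sf).
- by apply: smooth_sum => // i; apply: smoothM => //; exact: (der_smooth (d2 i) sf).
Qed.

Lemma elliptic_op_at_max f p : smooth_on V f -> V p -> (forall z, V z -> Im (f z) = 0) ->
  (\forall y \near p, Re (f y) <= Re (f p)) -> Re (L f p) <= 0.
Proof.
move=> sf Vp fR fmax.
(* The maximum of [Re f] kills the real part of the derivative. The imaginary part vanishes because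
   [f] equals its conjugate near [p]. *)
have dir0 v : dir_derive v f p = 0.
  have D := is_rderive_dir oV v sf Vp.
  have cE : \forall y \near p, (f y)^*%C = f y.
    apply: (open_near_eq oV Vp) => y /fR; case: (f y) => x x' /= ->.
    by rewrite oppr0.
  have D' := is_rderive_near cE (is_rderive_conj D).
  have := rderive_val D'; rewrite (rderive_val D).
  have := Re_rderive_at_max oV sf Vp fmax v.
  move: (dir_derive v f p) => [x y] /= -> [y2].
  by congr Complex; lra.
have rd v : rderive v f p = 0 by rewrite (rderive_val (is_rderive_dir oV v sf Vp)).
have z1 k : dz k f p = 0.
  by rewrite dzE /wirtinger !rd mulr0 addr0 mul0r.
have z2 k : dzbar k f p = 0.
  by rewrite dzbarE /wirtinger !rd mulr0 addr0 mul0r.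
rewrite /elliptic_op.
have -> : \sum_(i < n) X i p * dz i f p = 0 by apply: big1 => i _; rewrite z1 mulr0.
have -> : \sum_(i < n) Y i p * dzbar i f p = 0 by apply: big1 => i _; rewrite z2 mulr0.
rewrite !addr0; have [Q _ aE] := a_pos Vp; rewrite (sum_of_squares_trace _ aE) Re_sum.
apply: sumr_le0 => m _; have := hessian_at_max oV sf Vp fmax (row m Q).
by under eq_bigr do under eq_bigr do rewrite !mxE.
Qed.

End EllipticOperators.

(** * Hopf's boundary argument and the local maximum principle *)

Section StrongMaximumPrinciple.
Context {R : realType} {n : nat}.
Local Notation C := R[i].
Local Notation Cn := 'rV[R[i]]_n.
Local Notation Re := (@complex.Re _).
Local Notation Im := (@complex.Im _).
Variables (V : set Cn) (a : Cn -> 'M[C]_n) (X Y : 'I_n -> Cn -> C).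
Hypothesis oV : open V.
Hypothesis sa : forall i j, smooth_on V (fun z => a z i j).
Hypothesis sX : forall i, smooth_on V (X i).
Hypothesis sY : forall i, smooth_on V (Y i).
Hypothesis a_pos : forall z, V z -> sum_of_squares (a z).
Local Notation L := (elliptic_op a X Y).

#[local] Opaque smooth_on Ck_on rderive dz dzbar.

Variable f : Cn -> C.
Hypothesis sf : smooth_on V f.
Hypothesis f_real : forall z, V z -> Im (f z) = 0.
Hypothesis Lf : forall z, V z -> L f z = 0.

Lemma Re_continuous_on (g : Cn -> C) (A : set Cn) : A `<=` V -> smooth_on V g ->
  {within A, continuous (Re \o g)}.
Proof.
move=> AV sg; apply: continuous_in_subspaceT => z /set_mem /AV Vz.
by apply: continuous_comp; [exact: smooth_continuous sg Vz|exact: Re_continuous].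
Qed.

(* The barrier v = K q^2 - q, with q = |z - c|^2 - |w - c|^2, is positive just inside
   the ball, negative just outside it, and satisfies L v > 0 at w for large K. *)
Lemma barrier (c w : Cn) : V w -> w != c -> exists2 K : R, 0 < K &
  exists2 g : Cn -> C, smooth_on V g /\ (forall z, g z =
    (K * (sqdist c z - sqdist c w) ^+ 2 - (sqdist c z - sqdist c w))%:C%C) &
    \forall z \near w, 0 < Re (L g z).
Proof.
move=> Vw wc; pose k := (sqdist c w)%:C%C.
pose q z : C := sqdistC c z - k.
have sk : smooth_on V (fun=> k) by exact: smooth_cst.
have sd : smooth_on V (sqdistC c) by exact: smooth_sqdistC.
have sq : smooth_on V q by exact: smoothB.
have qE z : q z = (sqdist c z - sqdist c w)%:C%C.
  by rewrite /q sqdistC_real -rmorphB.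
have qw : q w = 0 by rewrite qE subrr.
have dq i : dz i q w = (w 0 i - c 0 i)^*%C.
  have d := dz_derivation oV i.
  by rewrite (derB oV d Vw sd sk) (der_cst d) subr0 (dz_sqdistC c i w).1.
have dbq i : dzbar i q w = w 0 i - c 0 i.
  have d := dzbar_derivation oV i.
  by rewrite (derB oV d Vw sd sk) (der_cst d) subr0 (dz_sqdistC c i w).2.
(* The gradient term of [L (q * q)] at [w], where [q] vanishes. It is positive because the
   derivatives of [q] there are the coordinates of [w - c] and their conjugates. *)
pose N := \sum_(i < n) \sum_(j < n) a w i j * (dz i q w * dzbar j q w).
have N0 : 0 < Re N.
  have wc0 : w - c != 0 by rewrite subr_eq0.
  have := sum_of_squares_gt0 (a_pos Vw) wc0; rewrite /N.
  under eq_bigr do under eq_bigr do rewrite !mxE.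
  by under [in X in _ -> X]eq_bigr do under eq_bigr do rewrite dq dbq.
(* Chosen so that the real part of [2 K N] exceeds that of [L q w], the two terms whose difference
   is [L g w]. *)
pose K := (`|Re (L q w)| + 1) / Re N.
have K0 : 0 < K by rewrite divr_gt0 // ltr_wpDl.
exists K => //; pose g z : C := K%:C%C * (q z * q z) + (-1) * q z.
have sqq : smooth_on V (fun z => q z * q z) by exact: smoothM.
have s1 : smooth_on V (fun z => K%:C%C * (q z * q z)).
  by apply: smoothM => //; exact: smooth_cst.
have s2 : smooth_on V (fun z => (-1) * q z).
  by apply: smoothM => //; exact: smooth_cst.
have sg : smooth_on V g by exact: smoothD.
exists g.
  split=> // z; rewrite /g qE expr2 -!rmorphM mulN1r -rmorphB; congr (_%:C%C).
have Lw : L g w = K%:C%C * (2 * N) - L q w.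
  rewrite (elliptic_opD a X Y oV Vw s1 s2) (elliptic_opZ a X Y oV _ Vw sqq).
  rewrite (elliptic_opZ a X Y oV _ Vw sq) (elliptic_op_sqr a X Y oV Vw sq).
  by rewrite qw mul0r mulr0 add0r mulN1r.
have Lw0 : 0 < Re (L g w).
  have alg (x y : C) (k' : R) : k' * Re y = `|Re x| + 1 -> 0 < Re (k'%:C%C * (2 * y) - x).
    move=> E; have -> : k'%:C%C * (2 * y) = k'%:C%C * y + k'%:C%C * y by ring.
    have := ler_norm (Re x); have := normr_ge0 (Re x).
    by case: x y E => [l l'] [m m'] /= E h1 h2; lra.
  by rewrite Lw; apply: alg; rewrite divfK ?gt_eqF.
have cL : {for w, continuous (Re \o L g)}.
  apply: continuous_comp; last exact: Re_continuous.
  exact: smooth_continuous (smooth_elliptic_op oV sa sX sY sg) Vw.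
have nb : nbhs (Re (L g w)) [set t : R | 0 < t].
  apply/nbhs_ballP; exists (Re (L g w)) => //= t.
  by rewrite -ball_normE /= ltr_norml => /andP[_ ?]; lra.
exact: (cL _ nb).
Qed.

(** On a small ball [B] about [w], perturb [f] to [u = f + e g] with the barrier [g]. On the sphere
    bounding [B], [Re u < m]: inside the large ball because [Re f < m] there and [e] is small,
    outside it because [g < 0]. As [u] has real part [m] at [w], its maximum over [B] is interior,
    where [L u <= 0] contradicts [L u = e L g > 0]. *)
Lemma hopf_boundary_point (m : R) (c w : Cn) : V w -> w != c -> Re (f w) = m ->
  (\forall z \near w, Re (f z) <= m) ->
  ~ (\forall z \near w, z != w -> sqdist c z <= sqdist c w -> Re (f z) < m).
Proof.
move=> Vw wc fw fle flt.
have [K K0 [g [sg gE] Lg]] := barrier Vw wc.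
pose q z := sqdist c z - sqdist c w.
have gRe z : Re (g z) = K * q z ^+ 2 - q z by rewrite gE.
have gIm z : Im (g z) = 0 by rewrite gE.
(* Makes [g = (K q - 1) q] negative wherever [q > 0], that is, outside the large ball. *)
have nq : \forall z \near w, K * q z < 1.
  have nb : nbhs (sqdist c w) [set t : R | K * (t - sqdist c w) < 1].
    apply/nbhs_ballP; exists K^-1; rewrite /= ?invr_gt0 // => t.
    rewrite -ball_normE /= distrC ltr_norml => /andP[_ h].
    by rewrite mulrC -ltr_pdivlMr // div1r.
  exact: (@sqdist_continuous _ _ c w _ nb).
have nV : \forall z \near w, V z by exact: open_nbhs_nbhs.
have [r r0 H] := nbhs_sqdist (filterI nV (filterI fle (filterI flt (filterI Lg nq)))).
pose B := [set z | sqdist w z <= r].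
have BV : B `<=` V by move=> z /H[].
pose A := [set z | sqdist w z = r /\ q z <= 0].
have AB : A `<=` B by move=> z [h _]; rewrite /B /= h.
have cA : compact A.
  apply: (subclosed_compact _ (@compact_sqdist _ _ w r)) => //.
  have -> : A = (sqdist w @^-1` [set r]) `&` (sqdist c @^-1` [set t | t <= sqdist c w]).
    by rewrite predeqE => z; split=> -[h1 h2]; split=> //; move: h2; rewrite /q /= subr_le0.
  apply: closedI; apply: closed_comp => [z _|]; try exact: sqdist_continuous.
    exact: closed_eq.
  exact: closed_le.
(* On the compact piece [A] of the small sphere, [Re f] has a maximum below [m] and [Re g] a
   maximum; [e] is the gap for [f] divided by a strict bound for [g]. *)
have [e e0 He] : exists2 e : R, 0 < e & forall z, A z -> Re (f z) + e * Re (g z) < m.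
  have [A0|/set0P A0] := eqVneq A set0.
    by exists 1 => // z; rewrite A0.
  have [x /set_mem Ax xmax] := compact_EVT_max A0 cA
    (Re_continuous_on (subset_trans AB BV) sf).
  have [y /set_mem Ay ymax] := compact_EVT_max A0 cA
    (Re_continuous_on (subset_trans AB BV) sg).
  have fx : Re (f x) < m.
    have [_ [_ [h _]]] := H x (AB x Ax); apply: h; last by case: Ax => _; rewrite subr_le0.
    by apply/eqP => xw; case: Ax => + _; rewrite xw sqdistxx => /eqP; rewrite lt_eqF.
  exists ((m - Re (f x)) / (`|Re (g y)| + 1)).
    by rewrite divr_gt0 ?subr_gt0 // ltr_wpDl.
  move=> z Az; have := xmax z (mem_set Az); have := ymax z (mem_set Az) => /= hy hx.
  set e := (X in X * _); have e0 : 0 < e by rewrite divr_gt0 ?subr_gt0 // ltr_wpDl.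
  have ee : e * (`|Re (g y)| + 1) = m - Re (f x) by rewrite divfK // gt_eqF // ltr_wpDl.
  have : e * Re (g z) <= e * `|Re (g y)|.
    by rewrite ler_pM2l //; apply: le_trans hy (ler_norm _).
  by lra.
pose u z : C := f z + e%:C%C * g z.
have seg : smooth_on V (fun z => e%:C%C * g z) by apply: smoothM => //; exact: smooth_cst.
have su : smooth_on V u by exact: smoothD.
have uRe z : Re (u z) = Re (f z) + e * Re (g z).
  by rewrite /u; case: (f z) (g z) => x y [x' y'] /=; rewrite mul0r subr0.
have uIm z : V z -> Im (u z) = 0.
  move=> /f_real; rewrite /u; have := gIm z.
  by case: (f z) (g z) => x y [x' y'] /= -> ->; rewrite mul0r mulr0 !addr0.
have Bw : B w by rewrite /B /= sqdistxx ltW.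
have B0 : B !=set0 by exists w.
have [p /set_mem Bp pmax] := compact_EVT_max B0 (@compact_sqdist _ _ w r)
  (Re_continuous_on BV su).
have up : m <= Re (u p).
  have := pmax w (mem_set Bw); rewrite /= !uRe gRe /q subrr expr0n /= mulr0 subr0 mulr0 addr0.
  by rewrite fw.
have [Vp [fp [_ [Lgp qp]]]] := H p Bp.
have pin : sqdist w p < r.
  rewrite lt_neqAle Bp andbT; apply/negP => /eqP pr.
  have [qp0|qp0] := leP (q p) 0.
    by have := He p (conj pr qp0); rewrite -uRe ltNge up.
  have gp : e * Re (g p) < 0.
    rewrite pmulr_rlt0 // gRe expr2 mulrA -[X in _ - X]mul1r -mulrBl pmulr_llt0 //.
    by rewrite subr_lt0.
  by move: up fp; rewrite uRe /=; lra.
have nmax : \forall z \near p, Re (u z) <= Re (u p).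
  have nb : nbhs (sqdist w p) [set t : R | t < r].
    apply/nbhs_ballP; exists (r - sqdist w p); rewrite /= ?subr_gt0 // => t.
    by rewrite -ball_normE /= distrC ltr_norml => /andP[_ ?]; lra.
  have : \forall z \near p, sqdist w z < r by exact: (@sqdist_continuous _ _ w p _ nb).
  by apply: filterS => z zr; apply: pmax; apply/mem_set; exact: ltW.
have := elliptic_op_at_max X Y oV a_pos su Vp uIm nmax.
rewrite (elliptic_opD a X Y oV Vp sf seg) (elliptic_opZ a X Y oV _ Vp sg) (Lf Vp) add0r.
have -> : Re (e%:C%C * L g p) = e * Re (L g p).
  by case: (L g p) => x y /=; rewrite mul0r subr0.
by rewrite leNgt mulr_gt0.
Qed.

(** Let [x] be near [z0] with [Re (f x)] different from [m], and let [w] be a maximum point nearest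
    to [x]. Every other point of the closed ball with diameter from [x] to [w] is strictly closer to
    [x], so near [w] the value [m] is taken in that ball at [w] alone. This is what
    [hopf_boundary_point] forbids. *)
Lemma strong_maximum_principle (m : R) (z0 : Cn) : V z0 ->
  (forall z, V z -> Re (f z) <= m) -> Re (f z0) = m ->
  \forall z \near z0, Re (f z) = m.
Proof.
move=> Vz0 fle fz0.
have nV : nbhs z0 V by exact: open_nbhs_nbhs.
have [r r0 BV] := nbhs_sqdist nV.
(* With [r / 4], [sqdist_triangle] gives [sqdist z0 w < r], since [w] is no farther from [x] than
   [z0] is. Hence [w] is interior to the ball on which it was chosen. *)
have : \forall z \near z0, sqdist z0 z < r / 4.
  have nb : nbhs (sqdist z0 z0) [set t : R | t < r / 4].
    rewrite sqdistxx; apply/nbhs_ballP; exists (r / 4); rewrite /= ?divr_gt0 // => t.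
    by rewrite -ball_normE /= sub0r normrN ltr_norml => /andP[].
  exact: (@sqdist_continuous _ _ z0 z0 _ nb).
apply: filterS => x xr; apply: contrapT => fx.
pose K := [set z | sqdist z0 z <= r /\ Re (f z) = m].
have cK : compact K.
  apply: (subclosed_compact _ (@compact_sqdist _ _ z0 r)); last by move=> z [].
  apply: closed_near => z nKz; have [zr|zr] := leP (sqdist z0 z) r.
    have Vz := BV z zr.
    have cf : {for z, continuous (Re \o f)}.
      by apply: continuous_comp; [exact: smooth_continuous sf Vz|exact: Re_continuous].
    have nb : nbhs (Re (f z)) [set t : R | t <> m].
      have ne : Re (f z) - m != 0 by rewrite subr_eq0; apply/eqP => ?; exact: nKz.
      apply/nbhs_ballP; exists `|Re (f z) - m|; first by rewrite /= normr_gt0.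
      by move=> t; rewrite -ball_normE /= => + tm; rewrite tm ltxx.
    have : \forall y \near z, Re (f y) <> m by exact: (cf _ nb).
    by apply: filterS => y h [].
  have nb : nbhs (sqdist z0 z) [set t : R | r < t].
    apply/nbhs_ballP; exists (sqdist z0 z - r); rewrite /= ?subr_gt0 // => t.
    by rewrite -ball_normE /= ltr_norml => /andP[_ ?]; lra.
  have : \forall y \near z, r < sqdist z0 y by exact: (@sqdist_continuous _ _ z0 z _ nb).
  by apply: filterS => y h [h' _]; move: h; rewrite ltNge h'.
have K0 : K !=set0 by exists z0; split; rewrite ?sqdistxx ?ltW.
have [w /set_mem Kw wmin] := compact_EVT_min K0 cK
  (continuous_subspaceT (@sqdist_continuous R n x)).
have [wr fw] := Kw; have Vw := BV w wr.
have xw : w != x by apply/eqP => wx; apply: fx; rewrite -wx.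
have wx : sqdist x w <= sqdist x z0.
  by apply: wmin; apply/mem_set; split; rewrite ?sqdistxx ?ltW.
have wr' : sqdist z0 w < r.
  by have := sqdist_triangle z0 x w; move: wx; rewrite (sqdist_sym x z0); lra.
apply: (@hopf_boundary_point m (2^-1 *: (x + w)) w) => //.
- apply: contra xw => /eqP E; apply/eqP.
  have n2 : (2 : C) != 0 by rewrite pnatr_eq0.
  have : 2 *: w = x + w by rewrite {1}E scalerA divff // scale1r.
  by rewrite scaler_nat mulr2n => /addIr.
- have : \forall z \near w, V z by exact: open_nbhs_nbhs.
  by apply: filterS => z; exact: fle.
have nb : nbhs (sqdist z0 w) [set t : R | t < r].
  apply/nbhs_ballP; exists (r - sqdist z0 w); rewrite /= ?subr_gt0 // => t.
  by rewrite -ball_normE /= distrC ltr_norml => /andP[_ ?]; lra.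
have : \forall z \near w, sqdist z0 z < r by exact: (@sqdist_continuous _ _ z0 w _ nb).
apply: filterS => z zr zw zc; rewrite lt_neqAle fle ?andbT; last exact: BV (ltW zr).
apply/eqP => fz; have Kz : K z by split; [exact: ltW|].
have := wmin z (mem_set Kz); rewrite leNgt => /negP; apply.
rewrite (sqdist_midpoint x w z).
have : sqdist w z != 0 by apply: contra zw => /eqP/sqdist_eq0 ->.
by have := sqdist_ge0 w z; rewrite le_eqVlt eq_sym => /orP[/eqP -> /eqP//|]; lra.
Qed.

End StrongMaximumPrinciple.

(** * The contracted equation *)

Section ContractedEquation.
Context {R : realType} {n : nat}.
Local Notation C := R[i].
Local Notation Cn := 'rV[R[i]]_n.
Implicit Types (f : Cn -> C) (z : Cn).

Lemma sum3_swap13 (G : 'I_n -> 'I_n -> 'I_n -> C) :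
  \sum_i \sum_j \sum_k G k j i = \sum_i \sum_j \sum_k G i j k.
Proof.
rewrite exchange_big /= [RHS]exchange_big /=; apply: eq_bigr => j _.
by rewrite exchange_big.
Qed.

Lemma sum4_swap13 (F : 'I_n -> 'I_n -> 'I_n -> 'I_n -> C) :
  \sum_i \sum_j \sum_k \sum_l F k j i l = \sum_i \sum_j \sum_k \sum_l F i j k l.
Proof. exact: (sum3_swap13 (fun i j k => \sum_l F i j k l)). Qed.

Lemma sum4_swap24 (F : 'I_n -> 'I_n -> 'I_n -> 'I_n -> C) :
  \sum_i \sum_j \sum_k \sum_l F i l k j = \sum_i \sum_j \sum_k \sum_l F i j k l.
Proof. by apply: eq_bigr => i _; exact: (sum3_swap13 (F i)). Qed.

Lemma sum4D (F G : 'I_n -> 'I_n -> 'I_n -> 'I_n -> C) :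
  \sum_i \sum_j \sum_k \sum_l (F i j k l + G i j k l) =
  \sum_i \sum_j \sum_k \sum_l F i j k l + \sum_i \sum_j \sum_k \sum_l G i j k l.
Proof.
rewrite -big_split; apply: eq_bigr => i _; rewrite -big_split; apply: eq_bigr => j _.
by rewrite -big_split; apply: eq_bigr => k _; rewrite -big_split.
Qed.

Lemma sum4N (F : 'I_n -> 'I_n -> 'I_n -> 'I_n -> C) :
  \sum_i \sum_j \sum_k \sum_l - F i j k l = - \sum_i \sum_j \sum_k \sum_l F i j k l.
Proof.
rewrite -sumrN; apply: eq_bigr => i _; rewrite -sumrN; apply: eq_bigr => j _.
by rewrite -sumrN; apply: eq_bigr => k _; rewrite -sumrN.
Qed.

Lemma sum4Z (x : C) (F : 'I_n -> 'I_n -> 'I_n -> 'I_n -> C) :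
  \sum_i \sum_j \sum_k \sum_l x * F i j k l = x * \sum_i \sum_j \sum_k \sum_l F i j k l.
Proof.
rewrite mulr_sumr; apply: eq_bigr => i _; rewrite mulr_sumr; apply: eq_bigr => j _.
by rewrite mulr_sumr; apply: eq_bigr => k _; rewrite mulr_sumr.
Qed.

Lemma sum4_eq (F G : 'I_n -> 'I_n -> 'I_n -> 'I_n -> C) :
  (forall i j k l, F i j k l = G i j k l) ->
  \sum_i \sum_j \sum_k \sum_l F i j k l = \sum_i \sum_j \sum_k \sum_l G i j k l.
Proof.
by move=> E; do 4![apply: eq_bigr => ? _]; exact: E.
Qed.

(* The weights of the trace of a (2,2)-form with respect to both index pairs. *)
Definition trace_weight (P : 'I_n -> 'I_n -> C) (i j k l : 'I_n) : C :=
  P i j * P k l - P k j * P i l.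

(** The weight changes sign when [i], [k] or [j], [l] are exchanged, so the four terms of the
    alternating sum have equal weighted traces, and four times the trace of [T] is zero. *)
Lemma trace_weight_alternating (P : 'I_n -> 'I_n -> C) (T : 'I_n -> 'I_n -> 'I_n -> 'I_n -> C) :
  (forall i j k l, T i j k l - T k j i l - T i l k j + T k l i j = 0) ->
  \sum_i \sum_j \sum_k \sum_l trace_weight P i j k l * T i j k l = 0.
Proof.
move=> alt; set S := LHS; pose W := trace_weight P.
have S1 : \sum_i \sum_j \sum_k \sum_l W i j k l * T k j i l = - S.
  rewrite /S -sum4N -[RHS]sum4_swap13; apply: sum4_eq => i j k l.
  by rewrite /= /W /trace_weight; ring.
have S2 : \sum_i \sum_j \sum_k \sum_l W i j k l * T i l k j = - S.
  rewrite /S -sum4N -[RHS]sum4_swap24; apply: sum4_eq => i j k l.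
  by rewrite /= /W /trace_weight; ring.
have S3 : \sum_i \sum_j \sum_k \sum_l W i j k l * T k l i j = S.
  rewrite /S -[RHS]sum4_swap13 -[RHS]sum4_swap24; apply: sum4_eq => i j k l.
  by rewrite /= /W /trace_weight; ring.
have : \sum_i \sum_j \sum_k \sum_l
    (W i j k l * T i j k l + - (W i j k l * T k j i l) + - (W i j k l * T i l k j) +
     W i j k l * T k l i j) = 0.
  apply: big1 => i _; apply: big1 => j _; apply: big1 => k _; apply: big1 => l _.
  rewrite -(mulr0 (W i j k l)) -(alt i j k l).
  by move: (W _ _ _ _) (T _ _ _ _) (T _ _ _ _) (T _ _ _ _) (T _ _ _ _) => w x y x' y'; ring.
rewrite !sum4D !sum4N S1 S2 S3 opprK -/S => E.
have : S *+ 4 = 0 by rewrite -[RHS]E !mulrS mulr0n; ring.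
by move/eqP; rewrite mulrn_eq0 /= => /eqP.
Qed.

Variables (V : set Cn) (d e : 'I_n -> (Cn -> C) -> Cn -> C).
Hypothesis oV : open V.
Hypothesis dd : forall k, derivation V (d k).
Hypothesis de : forall k, derivation V (e k).
Hypothesis ddC : forall k l f z, smooth_on V f -> V z -> d l (d k f) z = d k (d l f) z.
Hypothesis eeC : forall k l f z, smooth_on V f -> V z -> e l (e k f) z = e k (e l f) z.
Hypothesis edC : forall k l f z, smooth_on V f -> V z -> e l (d k f) z = d k (e l f) z.

#[local] Opaque smooth_on.

(** With [d] and [e] in the roles of [dz] and [dzbar], this is d d = 0 across an intermediate [e j]:
    antisymmetrising in [i], [k] kills third derivatives of this shape. [dee_swap] does the same for
    [j], [l]. *)
Lemma ded_swap i j k f z : smooth_on V f -> V z ->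
  d i (e j (d k f)) z = d k (e j (d i f)) z.
Proof.
move=> sf Vz; have sej := der_smooth (de j) sf.
have E m y : V y -> d m (e j f) y = e j (d m f) y by move=> Vy; rewrite edC.
rewrite (der_ext (dd i) Vz (E k) (der_smooth (dd k) sej)).
rewrite (der_ext (dd k) Vz (E i) (der_smooth (dd i) sej)).
exact: ddC.
Qed.

Lemma dee_swap i j l f z : smooth_on V f -> V z ->
  d i (e j (e l f)) z = d i (e l (e j f)) z.
Proof.
move=> sf Vz; apply: (der_ext (dd i) Vz); first by move=> y Vy; rewrite eeC.
exact: (der_smooth (de l) (der_smooth (de j) sf)).
Qed.

Variable h : Cn -> 'M[C]_n.
Hypothesis sh : forall i j, smooth_on V (fun z => h z i j).
Hypothesis uh : forall z, V z -> h z \in unitmx.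
Local Notation P := (hinv h).

Lemma smooth_hinv k l : smooth_on V (fun z => P z k l).
Proof. exact: smooth_invmx. Qed.

Lemma hinv_mulr z i k : V z -> \sum_l P z i l * h z k l = (i == k)%:R.
Proof.
move=> /uh u; have /matrixP/(_ k i) := mulmxV u; rewrite !mxE eq_sym => <-.
by apply: eq_bigr => l _; rewrite mulrC.
Qed.

Lemma hinv_mull z j l : V z -> \sum_k P z k j * h z k l = (j == l)%:R.
Proof. by move=> /uh u; have /matrixP/(_ j l) := mulVmx u; rewrite !mxE => <-. Qed.

Lemma derivation_hinv D z k l : derivation V D -> V z ->
  D (fun y => P y k l) z =
  - \sum_p \sum_q P z p l * P z k q * D (fun y => h y p q) z.
Proof.
move=> dD Vz.
(* The derivative of the constant [\sum_q P k q * h m q]. Contracting over [m] with another factor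
   [P] then isolates the derivative of [P]. *)
have E m : \sum_q h z m q * D (fun y => P y k q) z = - \sum_q P z k q * D (fun y => h y m q) z.
  apply/eqP; rewrite -addr_eq0 addrC -big_split /=; apply/eqP.
  rewrite -[RHS](der_cst dD ((k == m)%:R) z).
  have sM q : smooth_on V (fun y => P y k q * h y m q).
    by apply: smoothM => //; exact: smooth_hinv.
  have -> : D (fun=> (k == m)%:R) z = D (fun y => \sum_q P y k q * h y m q) z.
    apply: (der_ext dD Vz); last exact: smooth_sum.
    by move=> y Vy; rewrite hinv_mulr.
  rewrite (der_sum oV dD _ _ Vz sM); apply: eq_bigr => q _.
  rewrite (derM dD Vz (smooth_hinv k q) (sh m q)) addrC.
  by congr (_ + _); rewrite mulrC.
have -> : D (fun y => P y k l) z = \sum_q (l == q)%:R * D (fun y => P y k q) z.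
  rewrite (bigD1 l) //= eqxx mul1r big1 ?addr0 // => q ql.
  by rewrite eq_sym (negPf ql) mul0r.
under eq_bigr do rewrite -(hinv_mull _ _ Vz) mulr_suml.
rewrite exchange_big /= -sumrN; apply: eq_bigr => p _.
under eq_bigr do rewrite -mulrA.
rewrite -mulr_sumr E mulrN mulr_sumr; congr (- _).
by apply: eq_bigr => q _; rewrite mulrA.
Qed.

(** The [beta_j] of the overview. It is chart dependent, being one of the two terms of the trace of
    the conjugate torsion; the other is the trace of [e j h]. [lee_form_conj] is [alpha]. *)
Definition lee_form z (j : 'I_n) : C := \sum_k \sum_l P z k l * e l (fun y => h y k j) z.
Definition lee_form_conj z (i : 'I_n) : C := \sum_k \sum_l P z k l * d k (fun y => h y i l) z.

Lemma smooth_lee_form j : smooth_on V (lee_form ^~ j).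
Proof.
apply: smooth_sum => // k; apply: smooth_sum => // l; apply: smoothM => //.
  exact: smooth_hinv.
exact: (der_smooth (de l) (sh k j)).
Qed.

Lemma smooth_lee_form_conj i : smooth_on V (lee_form_conj ^~ i).
Proof.
apply: smooth_sum => // k; apply: smooth_sum => // l; apply: smoothM => //.
  exact: smooth_hinv.
exact: (der_smooth (dd k) (sh i l)).
Qed.

(** The bracket copies the shape of [chern]: for [D = dz i] and [F k l] the derivative [dzbar l] of
    the entry [k], [j] of [h], the right side is minus the definition of [chern_ricci3]. *)
Lemma derivation_hinv_trace D (F : 'I_n -> 'I_n -> Cn -> C) z : derivation V D -> V z ->
  (forall k l, smooth_on V (F k l)) ->
  D (fun y => \sum_k \sum_l P y k l * F k l y) z =
  - \sum_k \sum_l P z k l * (- D (F k l) z +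
      \sum_p \sum_q P z p q * F p l z * D (fun y => h y k q) z).
Proof.
move=> dD Vz sF.
have sM k l : smooth_on V (fun y => P y k l * F k l y).
  by apply: smoothM => //; exact: smooth_hinv.
rewrite (der_sum oV dD _ _ Vz); last by move=> k; exact: smooth_sum.
have -> : \sum_k D (fun y => \sum_l P y k l * F k l y) z =
   \sum_k \sum_l (D (fun y => P y k l) z * F k l z + P z k l * D (F k l) z).
  apply: eq_bigr => k _; rewrite (der_sum oV dD _ _ Vz (sM k)).
  by apply: eq_bigr => l _; rewrite (derM dD Vz (smooth_hinv k l) (sF k l)).
have -> : \sum_k \sum_l (D (fun y => P y k l) z * F k l z + P z k l * D (F k l) z) =
  - \sum_k \sum_l \sum_p \sum_q P z p l * P z k q * D (fun y => h y p q) z * F k l z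
  + \sum_k \sum_l P z k l * D (F k l) z.
  rewrite -sumrN -big_split; apply: eq_bigr => k _.
  rewrite -sumrN -big_split; apply: eq_bigr => l _ /=.
  rewrite (derivation_hinv _ _ dD Vz) mulNr mulr_suml; congr (- _ + _).
  by apply: eq_bigr => p _; rewrite mulr_suml.
have -> : \sum_k \sum_l \sum_p \sum_q P z p l * P z k q * D (fun y => h y p q) z * F k l z =
  \sum_k \sum_l P z k l * \sum_p \sum_q P z p q * F p l z * D (fun y => h y k q) z.
  rewrite -sum4_swap13; do 2![apply: eq_bigr => ? _]; rewrite mulr_sumr.
  apply: eq_bigr => p _; rewrite mulr_sumr; apply: eq_bigr => q _.
  by move: (P z _ _) (P z _ _) (F _ _ z) (D _ z) => x y f' g; ring.
rewrite -!sumrN -big_split; apply: eq_bigr => k _ /=.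
rewrite -!sumrN -big_split; apply: eq_bigr => l _ /=.
by rewrite mulrDr mulrN opprD opprK addrC.
Qed.

Section ScaledMetric.
Variable f : Cn -> C.
Hypothesis sf : smooth_on V f.
Hypothesis fhE : forall z k l, V z ->
  f z * h z k l = - d k (lee_form ^~ l) z - e l (lee_form_conj ^~ k) z.
Hypothesis h_pluriclosed : forall z i j k l, V z ->
  d i (e j (fun y => h y k l)) z - d k (e j (fun y => h y i l)) z
  - d i (e l (fun y => h y k j)) z + d k (e l (fun y => h y i j)) z = 0.

Let fh_second i j k l z : V z -> d i (e j (fun y => f y * h y k l)) z =
  - d i (e j (d k (lee_form ^~ l))) z - d i (e j (e l (lee_form_conj ^~ k))) z.
Proof.
move=> Vz; pose u := d k (lee_form ^~ l); pose v := e l (lee_form_conj ^~ k).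
have su : smooth_on V u := der_smooth (dd k) (smooth_lee_form l).
have sv : smooth_on V v := der_smooth (de l) (smooth_lee_form_conj k).
have s1 : smooth_on V (fun y => -1 * u y) by apply: smoothM => //; exact: smooth_cst.
have s2 : smooth_on V (fun y => -1 * v y) by apply: smoothM => //; exact: smooth_cst.
have s3 := smoothD oV s1 s2.
have E y : V y -> -1 * u y + -1 * v y = f y * h y k l.
  by move=> Vy; rewrite fhE // !mulN1r.
have Ee y : V y -> e j (fun y => -1 * u y + -1 * v y) y = e j (fun y => f y * h y k l) y.
  by move=> Vy; rewrite (der_ext (de j) Vy E s3).
rewrite (der_ext (dd i) Vz Ee (der_smooth (de j) s3)).
rewrite (der2D oV (dd i) (de j) Vz s1 s2) (der2Z oV (dd i) (de j) _ Vz su).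
by rewrite (der2Z oV (dd i) (de j) _ Vz sv) !mulN1r.
Qed.

(** After substitution of [fhE], the terms in [lee_form] cancel in pairs under exchange of [i] and
    [k], and those in [lee_form_conj] under exchange of [j] and [l]. *)
Lemma fh_pluriclosed i j k l z : V z ->
  d i (e j (fun y => f y * h y k l)) z - d k (e j (fun y => f y * h y i l)) z
  - d i (e l (fun y => f y * h y k j)) z + d k (e l (fun y => f y * h y i j)) z = 0.
Proof.
move=> Vz; rewrite !(fh_second _ _ _ _ Vz).
have E1 := ded_swap i j k (smooth_lee_form l) Vz.
have E2 := ded_swap i l k (smooth_lee_form j) Vz.
have E3 := dee_swap i j l (smooth_lee_form_conj k) Vz.
have E4 := dee_swap k j l (smooth_lee_form_conj i) Vz.
have alg (x1 x2 x3 x4 y1 y2 y3 y4 : C) : x1 = x2 -> x3 = x4 -> y1 = y3 -> y2 = y4 ->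
  (- x1 - y1) - (- x2 - y2) - (- x3 - y3) + (- x4 - y4) = 0.
  by move=> -> -> -> ->; ring.
exact: alg E1 E2 E3 E4.
Qed.

Definition second_order_coef z : 'M[C]_n :=
  \matrix_(i, j) \sum_k \sum_l trace_weight (P z) i j k l * h z k l.
(** Left uncontracted: the maximum principle asks for smoothness of the first order coefficients,
    not for their values. *)
Definition first_order_coef (i : 'I_n) z : C :=
  \sum_j \sum_k \sum_l trace_weight (P z) i j k l * e j (fun y => h y k l) z.
Definition first_order_coef_conj (j : 'I_n) z : C :=
  \sum_i \sum_k \sum_l trace_weight (P z) i j k l * d i (fun y => h y k l) z.

(** The first product of the weight traces [h] completely and gives [n] copies of [P i j]; the
    second contracts it with both factors and takes one copy away. *)
Lemma second_order_coefE z i j : V z -> second_order_coef z i j = (n%:R - 1) * P z i j.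
Proof.
move=> Vz; rewrite mxE.
have E k : \sum_l trace_weight (P z) i j k l * h z k l = P z i j - P z k j * (i == k)%:R.
  have -> : P z i j - P z k j * (i == k)%:R =
    P z i j * (\sum_l P z k l * h z k l) - P z k j * (\sum_l P z i l * h z k l).
    by rewrite !hinv_mulr // eqxx mulr1.
  rewrite !mulr_sumr -sumrB; apply: eq_bigr => l _.
  by rewrite /trace_weight; ring.
rewrite (eq_bigr _ (fun k _ => E k)) sumrB sumr_const card_ord.
rewrite (bigD1 i) //= eqxx mulr1 big1 ?addr0; last first.
  by move=> k ki; rewrite eq_sym (negPf ki) mulr0.
by rewrite mulrBl mul1r mulr_natl.
Qed.

Lemma smooth_trace_weight i j k l : smooth_on V (fun z => trace_weight (P z) i j k l).
Proof. by apply: smoothB => //; apply: smoothM => //; exact: smooth_hinv. Qed.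

Lemma smooth_second_order_coef i j : smooth_on V (fun z => second_order_coef z i j).
Proof.
have s : smooth_on V (fun z => \sum_k \sum_l trace_weight (P z) i j k l * h z k l).
  apply: smooth_sum => // k; apply: smooth_sum => // l; apply: smoothM => //.
  exact: smooth_trace_weight.
by apply: smooth_ext s => // z _; rewrite mxE.
Qed.

Lemma smooth_first_order_coef i : smooth_on V (first_order_coef i).
Proof.
do 3![apply: smooth_sum => // ?]; apply: smoothM => //; first exact: smooth_trace_weight.
exact: (der_smooth (de _) (sh _ _)).
Qed.

Lemma smooth_first_order_coef_conj i : smooth_on V (first_order_coef_conj i).
Proof.
do 3![apply: smooth_sum => // ?]; apply: smoothM => //; first exact: smooth_trace_weight.
exact: (der_smooth (dd _) (sh _ _)).
Qed.

(** The Leibniz rule leaves one term with [f] undifferentiated. Its double trace is [f] times that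
    of the second derivatives of [h], which is zero by [h_pluriclosed]. *)
Lemma contracted_equation z : V z ->
  \sum_i \sum_j second_order_coef z i j * d i (e j f) z +
  (\sum_i first_order_coef i z * d i f z + \sum_j first_order_coef_conj j z * e j f z) = 0.
Proof.
move=> Vz; have := trace_weight_alternating (P z)
  (fun i j k l => fh_pluriclosed i j k l Vz).
have S0 := trace_weight_alternating (P z) (fun i j k l => h_pluriclosed i j k l Vz).
have -> : \sum_i \sum_j \sum_k \sum_l
    trace_weight (P z) i j k l * d i (e j (fun y => f y * h y k l)) z =
  \sum_i \sum_j \sum_k \sum_l
   (trace_weight (P z) i j k l * h z k l * d i (e j f) z +
    trace_weight (P z) i j k l * e j (fun y => h y k l) z * d i f z +
    trace_weight (P z) i j k l * d i (fun y => h y k l) z * e j f z +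
    f z * (trace_weight (P z) i j k l * d i (e j (fun y => h y k l)) z)).
  apply: sum4_eq => i j k l; rewrite (der2M oV (dd i) (de j) Vz sf (sh k l)).
  move: (trace_weight _ _ _ _ _) (d i (e j f) z) (h z k l) (e j f z) (d i f z) (f z).
  move: (d i (fun y => h y k l) z) (e j (fun y => h y k l) z).
  move: (d i (e j (fun y => h y k l)) z) => x1 x2 x3 x4 x5 x6 x7 x8 x9; ring.
rewrite !sum4D.
rewrite sum4Z S0 mulr0 addr0 -addrA => H; rewrite -[RHS]H; congr (_ + (_ + _)).
- apply: eq_bigr => i _; apply: eq_bigr => j _; rewrite mxE mulr_suml.
  by apply: eq_bigr => k _; rewrite mulr_suml.
- apply: eq_bigr => i _; rewrite mulr_suml; apply: eq_bigr => j _.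
  by rewrite mulr_suml; apply: eq_bigr => k _; rewrite mulr_suml.
rewrite [RHS]exchange_big; apply: eq_bigr => j _; rewrite mulr_suml.
apply: eq_bigr => i _; rewrite mulr_suml.
by apply: eq_bigr => k _; rewrite mulr_suml.
Qed.

End ScaledMetric.
End ContractedEquation.

(** * Chern-Ricci curvatures and coefficients of forms *)

Section ChernRicci.
Context {R : realType} {n : nat}.
Local Notation C := R[i].
Local Notation Cn := 'rV[R[i]]_n.
Variables (V : set Cn) (h : Cn -> 'M[C]_n).
Hypothesis oV : open V.
Hypothesis sh : forall i j, smooth_on V (fun z => h z i j).
Hypothesis uh : forall z, V z -> h z \in unitmx.
Local Notation P := (hinv h).

#[local] Opaque smooth_on dz dzbar.

Lemma chern_ricci3E z i j : V z ->
  chern_ricci3 h z i j = - dz i (fun y => lee_form (@dzbar R n) h y j) z.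
Proof.
move=> Vz; have d := dz_derivation oV i.
rewrite (derivation_hinv_trace oV sh uh (F := fun k l => dzbar l (fun y => h y k j)) d Vz).
  by rewrite opprK mxE.
by move=> k l; exact: (der_smooth (dzbar_derivation oV l) (sh k j)).
Qed.

Lemma chern_ricci4E z i j : V z ->
  chern_ricci4 h z i j = - dzbar j (fun y => lee_form_conj (@dz R n) h y i) z.
Proof.
move=> Vz; have d := dzbar_derivation oV j.
rewrite (derivation_hinv_trace oV sh uh (F := fun k l => dz k (fun y => h y i l)) d Vz);
  last by move=> k l; exact: (der_smooth (dz_derivation oV k) (sh i l)).
rewrite opprK mxE.
have E (F G : 'I_n -> 'I_n -> C) : (forall k l, F k l = G k l) ->
    \sum_k \sum_l F k l = \sum_k \sum_l G k l.
  by move=> FG; do 2![apply: eq_bigr => ? _]; exact: FG.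
pose A k l := - (P z k l * dz k (dzbar j (fun y => h y i l)) z).
pose B k l p q := P z k l * (P z p q * dzbar j (fun y => h y p l) z * dz k (fun y => h y i q) z).
transitivity (\sum_k \sum_l (A k l + \sum_p \sum_q B k l p q)).
  apply: E => k l; rewrite /chern mulrDr mulrN mulr_sumr; congr (_ + _).
  by apply: eq_bigr => p _; rewrite mulr_sumr.
(* The quadratic part of [chern_ricci4] has its two inverse-metric index pairs in the opposite roles
   to those in [derivation_hinv_trace]; renaming both pairs aligns them. *)
have S : \sum_k \sum_l \sum_p \sum_q B k l p q = \sum_k \sum_l \sum_p \sum_q B p q k l.
  by rewrite -(sum4_swap13 B) -(sum4_swap24 (fun k l p q => B p l k q)).
transitivity (\sum_k \sum_l (A k l + \sum_p \sum_q B p q k l)).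
  have D (T : 'I_n -> 'I_n -> C) : \sum_k \sum_l (A k l + T k l) =
      \sum_k \sum_l A k l + \sum_k \sum_l T k l.
    by rewrite -big_split; apply: eq_bigr => k _; rewrite -big_split.
  by rewrite (D (fun k l => \sum_p \sum_q B k l p q)) S -D.
apply: E => k l; rewrite mulrDr mulrN mulr_sumr; congr (_ + _).
  by rewrite /A (dz_dzbar_comm oV _ _ (sh i l) Vz).
apply: eq_bigr => p _; rewrite mulr_sumr; apply: eq_bigr => q _; rewrite /B.
move: (P z p q) (P z k l) (dzbar j (fun y => h y k q) z) (dz p (fun y => h y i l) z).
by move=> a b c d'; ring.
Qed.

Lemma trace_chern_ricci3 z :
  \sum_i \sum_j P z i j * chern_ricci3 h z i j = chern_scalar2 h z.
Proof.
pose F i j k l := P z i l * P z k j * chern h z i j k l.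
rewrite /chern_scalar2 -(sum4_swap24 F).
apply: eq_bigr => i _; apply: eq_bigr => j _; rewrite mxE mulr_sumr; apply: eq_bigr => k _.
by rewrite mulr_sumr; apply: eq_bigr => l _; rewrite mulrA.
Qed.

Lemma trace_chern_ricci4 z :
  \sum_i \sum_j P z i j * chern_ricci4 h z i j = chern_scalar2 h z.
Proof.
pose F i j k l := P z i l * P z k j * chern h z i j k l.
rewrite /chern_scalar2 -(sum4_swap13 F).
apply: eq_bigr => i _; apply: eq_bigr => j _; rewrite mxE mulr_sumr; apply: eq_bigr => k _.
by rewrite mulr_sumr; apply: eq_bigr => l _; rewrite mulrA [P z i j * _]mulrC.
Qed.

Lemma chern_scalar2E (c : C) z : V z ->
  (forall i j, chern_ricci3 h z i j + chern_ricci4 h z i j = c * h z i j) ->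
  chern_scalar2 h z = n%:R * c / 2.
Proof.
move=> Vz E.
have S : chern_scalar2 h z + chern_scalar2 h z = n%:R * c.
  rewrite -{1}trace_chern_ricci3 -trace_chern_ricci4 -big_split /=.
  transitivity (\sum_(i < n) c); last by rewrite sumr_const card_ord mulr_natl.
  have H i : \sum_l P z i l * h z i l = 1 by rewrite (hinv_mulr uh i i Vz) eqxx.
  apply: eq_bigr => i _; rewrite -big_split /= -[RHS]mulr1 -(H i) mulr_sumr.
  by apply: eq_bigr => j _; rewrite -mulrDr E mulrCA.
by rewrite -S; field.
Qed.

End ChernRicci.

(** * Coefficients of exterior derivatives and the pluriclosed condition in components *)

Section FormCoefficients.
Context {R : realType} {n : nat}.
Local Notation C := R[i].
Local Notation Cn := 'rV[R[i]]_n.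
Implicit Types (a b : dform R n) (z : Cn).

#[local] Opaque dz dzbar.

Lemma shuffle_sign1 (j : 'I_(n + n)) (T : {set 'I_(n + n)}) :
  shuffle_sign [set j]%SET T = (-1) ^+ #|[set t in T | (t < j)%N]%SET| :> C.
Proof.
rewrite /shuffle_sign; congr (_ ^+ _).
have inj : injective (fun t : 'I_(n + n) => (j, t)) by move=> x y [].
rewrite -(card_imset _ inj); apply: eq_card => -[x y]; rewrite !inE /=.
apply/idP/imsetP => [/andP[/andP[/eqP -> yT] yj]|[t + [-> ->]]].
  by exists y => //; rewrite !inE yT.
by rewrite !inE eqxx.
Qed.

Lemma ext_wedge_gen (j : 'I_(n + n)) b S z : ext_wedge (gen j) b S z =
  if j \in S then (-1) ^+ #|[set t in S :\ j | (t < j)%N]%SET| * b (S :\ j) z else 0.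
Proof.
rewrite /ext_wedge /gen; case: ifP => jS; last first.
  apply: big1 => A AS; case: eqP => [E|_]; last by rewrite mulr0 mul0r.
  by move: AS; rewrite E finset.sub1set jS.
rewrite (bigD1 [set j]%SET) ?finset.sub1set //= eqxx mulr1 shuffle_sign1 big1 ?addr0 //.
by move=> A /andP[_ /negPf ->]; rewrite mulr0 mul0r.
Qed.

Lemma gen_wedge_gen (i j : 'I_n) S z :
  ext_wedge (gen (lshift n i)) (gen (rshift n j)) S z =
  (S == [set lshift n i; rshift n j]%SET)%:R :> C.
Proof.
rewrite ext_wedge_gen; case: ifP => iS; last first.
  by case: eqP => // E; move: iS; rewrite E !inE eqxx.
rewrite /gen; have [E|nE] := eqVneq (S :\ lshift n i)%SET [set rshift n j]%SET.
  have -> : [set t in (S :\ lshift n i)%SET | (t < lshift n i)%N]%SET = finset.set0.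
    apply/setP => t; rewrite E !inE; apply/negbTE/negP => /andP[/eqP ->] /=.
    by rewrite ltnNge (leq_trans (ltnW (ltn_ord i)) (leq_addr _ _)).
  by rewrite finset.cards0 expr0 mul1r -E finset.setD1K // eqxx.
rewrite mulr0; case: eqP => // E; case/eqP: nE; apply/setP => t.
rewrite E !inE; case: (eqVneq t (lshift n i)) => //= ->.
by rewrite eq_lrshift.
Qed.

Lemma form_of_mxE (A : Cn -> 'M[C]_n) (i j : 'I_n) z :
  form_of_mx A [set lshift n i; rshift n j]%SET z = 'i%C * A z i j.
Proof.
have inj (i' j' : 'I_n) : ([set lshift n i; rshift n j]%SET ==
    [set lshift n i'; rshift n j']%SET) = (i == i') && (j == j').
  apply/eqP/andP => [/setP E|[/eqP -> /eqP ->] //].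
  have := E (lshift n i); rewrite !inE eqxx eq_lshift !eq_lrshift /= orbF => <-.
  by have := E (rshift n j); rewrite !inE eqxx eq_rshift !eq_rlshift /= => <-.
rewrite /form_of_mx (bigD1 i) //= (bigD1 j) //= gen_wedge_gen eqxx mulr1.
rewrite !big1 ?addr0 // => [i' i'i|j' j'j]; last first.
  by rewrite gen_wedge_gen inj eqxx [j == j']eq_sym (negPf j'j) mulr0.
by apply: big1 => j' _; rewrite gen_wedge_gen inj [i == i']eq_sym (negPf i'i) mulr0.
Qed.

(** Holomorphic indices come first, as in the ordering of the generators. Being a set, it forgets
    order and repetitions, so signs are read off only for [i < k] and [j < l]. *)
Definition gens4 (i k j l : 'I_n) : {set 'I_(n + n)} :=
  [set lshift n i; lshift n k; rshift n j; rshift n l]%SET.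

Definition gens3 (k j l : 'I_n) : {set 'I_(n + n)} :=
  [set lshift n k; rshift n j; rshift n l]%SET.

Lemma sum_two_terms (F : 'I_n -> C) (i k : 'I_n) : (i == k) = false ->
  (forall m, m != i -> m != k -> F m = 0) -> \sum_m F m = F i + F k.
Proof.
move=> ik F0; rewrite (bigD1 i) //= (bigD1 k) ?(eq_sym k) ?ik //= big1 ?addr0 //.
by move=> m /andP[]; exact: F0.
Qed.

Lemma delE a (i k j l : 'I_n) z : (i < k)%N ->
  del a (gens4 i k j l) z = dz i (a (gens3 k j l)) z - dz k (a (gens3 i j l)) z.
Proof.
move=> ik; have ne : (i == k) = false by apply/negbTE; rewrite neq_ltn ik.
have ne' : (k == i) = false by rewrite eq_sym.
rewrite /del (sum_two_terms ne); last first.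
  move=> m mi mk; rewrite ext_wedge_gen ifF //.
  by rewrite !inE !eq_lshift !eq_lrshift (negPf mi) (negPf mk).
rewrite !ext_wedge_gen !inE !eqxx orbT /=.
have -> : (gens4 i k j l :\ lshift n i)%SET = gens3 k j l.
  apply/setP => t; rewrite !inE; case: (eqVneq t (lshift n i)) => //= ->.
  by rewrite eq_lshift ne !eq_lrshift.
have -> : (gens4 i k j l :\ lshift n k)%SET = gens3 i j l.
  apply/setP => t; rewrite !inE; case: (eqVneq t (lshift n k)) => //= [->|_].
    by rewrite eq_lshift ne' !eq_lrshift.
  by rewrite orbF.
have rl (x y : 'I_n) : (rshift n x < lshift n y)%N = false.
  by apply/negbTE; rewrite -leqNgt /= (leq_trans (ltnW (ltn_ord y)) (leq_addr _ _)).
have -> : [set t in gens3 k j l | (t < lshift n i)%N]%SET = finset.set0.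
  apply/setP => t; rewrite !inE; apply/negbTE/negP => /andP[/orP[/orP[]|] /eqP ->]; rewrite ?rl //=.
  by rewrite ltnNge (ltnW ik).
have -> : [set t in gens3 i j l | (t < lshift n k)%N]%SET = [set lshift n i]%SET.
  apply/setP => t; rewrite !inE; apply/andP/eqP => [[/orP[/orP[]|] /eqP ->]|->]; rewrite ?rl //.
  by rewrite eqxx.
by rewrite finset.cards0 finset.cards1 expr0 expr1 mul1r mulN1r.
Qed.

(** The generator dzbar^j passes dz^k, hence the minus sign; dzbar^l passes two generators. *)
Lemma delbarE a (k j l : 'I_n) z : (j < l)%N -> delbar a (gens3 k j l) z =
  - dzbar j (a [set lshift n k; rshift n l]%SET) z
  + dzbar l (a [set lshift n k; rshift n j]%SET) z.
Proof.
move=> jl; have ne : (j == l) = false by apply/negbTE; rewrite neq_ltn jl.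
have ne' : (l == j) = false by rewrite eq_sym.
rewrite /delbar (sum_two_terms ne); last first.
  move=> m mi mk; rewrite ext_wedge_gen ifF //.
  by rewrite !inE !eq_rshift !eq_rlshift (negPf mi) (negPf mk).
rewrite !ext_wedge_gen !inE !eqxx !orbT /=.
have -> : (gens3 k j l :\ rshift n j)%SET = [set lshift n k; rshift n l]%SET.
  apply/setP => t; rewrite !inE; case: (eqVneq t (rshift n j)) => //= [->|_].
    by rewrite eq_rshift ne !eq_rlshift.
  by rewrite orbF.
have -> : (gens3 k j l :\ rshift n l)%SET = [set lshift n k; rshift n j]%SET.
  apply/setP => t; rewrite !inE; case: (eqVneq t (rshift n l)) => //= [->|_].
    by rewrite eq_rshift ne' !eq_rlshift.
  by rewrite orbF.
have lr (x y : 'I_n) : (lshift n x < rshift n y)%N.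
  by rewrite /= (leq_trans (ltn_ord x)) // leq_addr.
have rr (x y : 'I_n) : (rshift n x < rshift n y)%N = (x < y)%N by rewrite /= ltn_add2l.
have -> : [set t in [set lshift n k; rshift n l]%SET | (t < rshift n j)%N]%SET =
    [set lshift n k]%SET.
  apply/setP => t; rewrite !inE; apply/andP/eqP => [[/orP[] /eqP ->]|->] //.
    by rewrite rr ltnNge (ltnW jl).
  by rewrite eqxx lr.
have -> : [set t in [set lshift n k; rshift n j]%SET | (t < rshift n l)%N]%SET =
    [set lshift n k; rshift n j]%SET.
  apply/setP => t; rewrite !inE; apply/andP/idP => [[]//|] E; split=> //.
  by move/orP: E => [] /eqP ->; [exact: lr|rewrite rr].
rewrite finset.cards1 finset.cards2 eq_lrshift /= expr1 mulN1r.
by rewrite expr2 mulN1r opprK mul1r.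
Qed.

Section Pluriclosed.
Variables (V : set Cn) (h : Cn -> 'M[C]_n).
Hypothesis oV : open V.
Hypothesis sh : forall i j, smooth_on V (fun z => h z i j).
Hypothesis h_pc : form_zero_on V (del (delbar (form_of_mx h))).

#[local] Opaque smooth_on dz dzbar.

Local Notation T z i j k l := (dz i (dzbar j (fun y => h y k l)) z).

Let pluriclosed_lt z (i j k l : 'I_n) : V z -> (i < k)%N -> (j < l)%N ->
  T z i j k l - T z k j i l - T z i l k j + T z k l i j = 0.
Proof.
move=> Vz ik jl; have := h_pc (gens4 i k j l) Vz; rewrite delE //.
have D (i' k' : 'I_n) : dz i' (delbar (form_of_mx h) (gens3 k' j l)) z =
    'i%C * (T z i' l k' j - T z i' j k' l).
  have dl := dzbar_derivation oV l; have dj := dzbar_derivation oV j.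
  have di := dz_derivation oV i'.
  have F (p q : 'I_n) : form_of_mx h [set lshift n p; rshift n q]%SET =
      (fun y => 'i%C * h y p q) by apply/funext => y; exact: form_of_mxE.
  have s1 : smooth_on V (dzbar l (fun y => h y k' j)) := der_smooth dl (sh k' j).
  have s2 : smooth_on V (dzbar j (fun y => h y k' l)) := der_smooth dj (sh k' l).
  have t1 : smooth_on V (fun y => 'i%C * dzbar l (fun y => h y k' j) y).
    by apply: smoothM => //; exact: smooth_cst.
  have t2 : smooth_on V (fun y => - 'i%C * dzbar j (fun y => h y k' l) y).
    by apply: smoothM => //; exact: smooth_cst.
  have E y : V y -> 'i%C * dzbar l (fun y => h y k' j) y +
      (- 'i%C) * dzbar j (fun y => h y k' l) y = delbar (form_of_mx h) (gens3 k' j l) y.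
    move=> Vy; rewrite delbarE // !F (derZ oV dl _ Vy (sh k' j)) (derZ oV dj _ Vy (sh k' l)).
    by rewrite mulNr addrC.
  rewrite (der_ext di Vz E (smoothD oV t1 t2)) (derD di Vz t1 t2).
  by rewrite (derZ oV di _ Vz s1) (derZ oV di _ Vz s2) mulNr mulrBr.
rewrite !D -mulrBr => /eqP; rewrite mulf_eq0 => /orP[/eqP i0|/eqP E].
  by have [/eqP] := i0; rewrite oner_eq0.
have alg (x1 x2 x3 x4 : C) : (x3 - x1) - (x4 - x2) = 0 -> x1 - x2 - x3 + x4 = 0.
  by move=> e; rewrite -[RHS]oppr0 -e; ring.
exact: alg E.
Qed.

(** Form coefficients give the identity for [i < k] and [j < l]. The expression is antisymmetric in
    each pair, which yields the other orders and makes the diagonal cases trivial. *)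
Lemma pluriclosed_second z i j k l : V z ->
  T z i j k l - T z k j i l - T z i l k j + T z k l i j = 0.
Proof.
move=> Vz.
have alg1 (x y x' y' : C) : x - y - x' + y' = 0 -> y - x - y' + x' = 0.
  by move=> E; rewrite -[RHS]oppr0 -E; ring.
have alg2 (x y x' y' : C) : x - y - x' + y' = 0 -> x' - y' - x + y = 0.
  by move=> E; rewrite -[RHS]oppr0 -E; ring.
have alg3 (x y : C) : x - x - y + y = 0 by ring.
have alg4 (x y : C) : x - y - x + y = 0 by ring.
have lt_jl (i' k' : 'I_n) : (i' < k')%N ->
    T z i' j k' l - T z k' j i' l - T z i' l k' j + T z k' l i' j = 0.
  move=> ik; have [jl|lj|/val_inj ->] := ltngtP j l.
  - exact: pluriclosed_lt.
  - by apply: alg2; exact: pluriclosed_lt.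
  exact: alg4.
have [ik|ki|/val_inj ->] := ltngtP i k.
- exact: lt_jl.
- by apply: alg1; exact: lt_jl.
exact: alg3.
Qed.

End Pluriclosed.
End FormCoefficients.

(** * Compact manifolds *)

Section InverseMetric.
Context {R : realType} {n : nat}.
Local Notation C := R[i].

(** Diagonalise [A] by a unitary [U] with eigenvalues [D]. Then the inverse has eigenvalues 1 / D,
    and scaling row [m] of [U] by the square root of [t / D 0 m] gives the matrix [Q]. The
    transposition in the formula for [B] is that of [hinv]; [t] will be [n - 1]. *)
Lemma positive_hermitian_inverse (A : 'M[C]_n) (t : C) : 0 < t ->
  (forall i j, A j i = ((A i j)^*)%C) ->
  (forall v : 'rV[C]_n, v != 0 ->
    0 < \sum_(i < n) \sum_(j < n) A i j * v 0 i * ((v 0 j)^*)%C) ->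
  A \in unitmx /\ forall B : 'M[C]_n,
    (forall i j, B i j = t * invmx A j i) -> sum_of_squares B.
Proof.
move=> t0 Aherm Apos.
have hA : A \is hermsymmx.
  apply/is_hermitianmxP; rewrite expr0 scale1r.
  by apply/matrixP => i j; rewrite !mxE Aherm.
have /orthomx_spectralP := hermitian_normalmx hA.
set U := spectralmx A; set D := spectral_diag A; move=> AE.
have uU : U \in unitmx := spectral_unit A.
have WE i m : invmx U i m = ((U m i)^*)%C.
  by rewrite (invmx_unitary (spectral_unitarymx A)) !mxE.
(* The eigenvalue is the value of the form on row [m] of [U], which is nonzero since [U] is
   invertible. *)
have D0 m : 0 < D 0 m.
  have U0 : row m U != 0.
    apply/eqP => Um; have /matrixP/(_ m m) := mulmxV uU.
    rewrite mxE big1 => [|k _]; last first.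
      by have /rowP/(_ k) := Um; rewrite !mxE => ->; rewrite mul0r.
    by rewrite !mxE eqxx => /esym/eqP; rewrite oner_eq0.
  have := Apos _ U0.
  have /matrixP/(_ m m) : U *m A *m invmx U = diag_mx D.
    by rewrite {1}AE !mulmxA mulmxV // mul1mx -mulmxA mulmxV // mulmx1.
  rewrite [RHS]mxE eqxx mulr1n => <-; rewrite mxE.
  under [in X in _ -> X]eq_bigr do rewrite mxE mulr_suml.
  rewrite exchange_big /=; congr (0 < _); apply: eq_bigr => i _; apply: eq_bigr => j _.
  by rewrite !mxE WE [_ * A _ _]mulrC.
pose E := \row_m (D 0 m)^-1.
have AI : A *m (invmx U *m diag_mx E *m U) = 1%:M.
  rewrite {1}AE !mulmxA -(mulmxA _ U) mulmxV // mulmx1 -(mulmxA _ (diag_mx D)).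
  have -> : diag_mx D *m diag_mx E = 1%:M.
    apply/matrixP => i j; rewrite mul_diag_mx !mxE; case: (i == j); rewrite ?mulr0 //.
    by rewrite !mulr1n divff // gt_eqF.
  by rewrite mulmx1 mulVmx.
have [uA _] := mulmx1_unit AI; split=> // B BE.
have IE : invmx A = invmx U *m diag_mx E *m U.
  by rewrite -[RHS](mulKmx uA) AI mulmx1.
pose s := \row_m sqrtC (t / D 0 m).
have s0 m : 0 < s 0 m by rewrite mxE sqrtC_gt0 divr_gt0.
exists (diag_mx s *m U).
  rewrite unitmx_mul uU andbT unitmxE det_diag unitfE.
  by apply/prodf_neq0 => m _; rewrite gt_eqF.
move=> i j; rewrite BE IE mxE mulr_sumr; apply: eq_bigr => m _.
rewrite mul_mx_diag mul_diag_mx !mxE WE rmorphM /=.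
have -> : ((sqrtC (t / D 0 m))^*)%C = sqrtC (t / D 0 m).
  by apply: (@geC0_conj C); rewrite sqrtC_ge0 ltW // divr_gt0.
have := sqrtCK (t / D 0 m); rewrite expr2; move: (sqrtC _) => r rE.
transitivity (t / D 0 m * U m i * ((U m j)^*)%C); last first.
  by rewrite -rE; move: (U m i) ((U m j)^*)%C => x y; ring.
by move: (U m i) ((U m j)^*)%C (D 0 m)^-1 => x y d'; ring.
Qed.

End InverseMetric.

(** * From local statements in charts to the compact connected manifold *)

Section CompactManifold.
Context {R : realType} {n : nat} {M : complex_manifold R n}.
Local Notation C := R[i].
Local Notation Re := (@complex.Re _).

Lemma in_chartK (f : M -> R) (c : chart R n M) x : cdom c x ->
  in_chart f c (cmap c x) = (f x)%:C%C.
Proof. by move=> cx; rewrite /in_chart cmapK. Qed.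

Lemma near_cdom (c : chart R n M) x : cdom c x -> \forall y \near x, cdom c y.
Proof. by move=> cx; apply: open_nbhs_nbhs; split=> //; exact: cdom_open. Qed.

Lemma smooth_function_continuous (f : M -> R) : smooth_function f -> continuous f.
Proof.
move=> sf x P nP; have [c ac cx] := atlas_cover x.
have cF : {for cmap c x, continuous (Re \o in_chart f c)}.
  apply: continuous_comp; last exact: Re_continuous.
  by apply: (smooth_continuous (sf c ac)); exists x.
have nP' : nbhs ((Re \o in_chart f c) (cmap c x)) P by rewrite /= cmapK.
have := cmap_continuous cx (cF P nP').
apply: filterS2 (near_cdom cx) => y cy.
by rewrite /= cmapK.
Qed.

(** The set where the maximum is attained is nonempty by compactness, closed by continuity and open
    by the last premise, hence everything by connectedness. *)
Lemma constant_of_open_max (f : M -> R) : compact [set: M] -> continuous f ->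
  (forall x, (forall y, f y <= f x) -> \forall y \near x, f y = f x) ->
  forall x y, f x = f y.
Proof.
move=> cM cf fmax x y.
have M0 : [set: M] !=set0 by exists x.
have [p _ pmax] := compact_EVT_max M0 cM (continuous_subspaceT cf).
have {}pmax z : f z <= f p by apply: pmax; rewrite inE.
pose A := [set z | f z = f p].
suff AT : A = [set: M] by have : A x /\ A y by [rewrite AT]; move=> [-> ->].
have E : forall B : set M, B = [set: M] `&` B by move=> B; rewrite setTI.
apply: (@points_connected R n M).
- by exists p.
- exists A => //; rewrite openE => z /= Az.
  have : \forall w \near z, f w = f z by apply: fmax => w; rewrite Az.
  by apply: filterS => w fw; rewrite /A /= fw.
exists A => //; have -> : A = f @^-1` [set f p] by [].
by apply: closed_comp => [z _|]; [exact: cf|exact: closed_eq].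
Qed.

Variable omega : hermitian_metric M.
Hypothesis hn : (2 <= n)%N.

Section InChart.
Variable c : chart R n M.
Hypothesis ac : atlas c.
Local Notation V := (ccod c).
Local Notation h := (omega c).

(** The place where [n >= 2] enters: this is the factor of the principal part in
    [second_order_coefE]. *)
Let n1 : 0 < n%:R - 1 :> C.
Proof. by rewrite subr_gt0 ltr1n. Qed.

Lemma metric_unit z : V z -> h z \in unitmx.
Proof.
by move=> Vz; have [] := positive_hermitian_inverse n1 (metric_herm omega ac Vz) (metric_pos omega ac Vz).
Qed.

Lemma second_order_coef_pos z : V z -> sum_of_squares (second_order_coef h z).
Proof.
move=> Vz; have [_] := positive_hermitian_inverse n1 (metric_herm omega ac Vz) (metric_pos omega ac Vz).
by apply=> i j; rewrite (second_order_coefE metric_unit).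
Qed.

Variable f : M -> R.
Hypothesis f_smooth : smooth_function f.
Hypothesis omega_pluriclosed : pluriclosed omega.
Hypothesis f_curv : form_eq_on V (form_add (Theta3 omega c) (Theta4 omega c))
  (form_scale (in_chart f c) (fundamental_form omega c)).

Lemma chern_ricci_sum z i j : V z ->
  chern_ricci3 h z i j + chern_ricci4 h z i j = in_chart f c z * h z i j.
Proof.
move=> Vz.
have alg (a b d x y w t : C) : x = 'i%C * a -> y = 'i%C * b -> w = 'i%C * d ->
    x + y = t * w -> a + b = t * d.
  move=> -> -> ->; rewrite -mulrDr mulrCA; apply: mulfI.
  by apply/eqP => -[/eqP]; rewrite oner_eq0.
exact: (alg _ _ _ _ _ _ _ (form_of_mxE (chern_ricci3 h) i j z)
  (form_of_mxE (chern_ricci4 h) i j z) (form_of_mxE h i j z) (f_curv _ Vz)).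
Qed.

Lemma in_chart_near_max z0 m : V z0 -> (forall z, V z -> Re (in_chart f c z) <= m) ->
  Re (in_chart f c z0) = m -> \forall z \near z0, Re (in_chart f c z) = m.
Proof.
have oV : open V by exact: ccod_open.
have sh := metric_smooth omega ac; have uh := metric_unit.
have d1 := dz_derivation oV; have d2 := dzbar_derivation oV.
have sF := f_smooth ac.
have C1 k l g y : smooth_on V g -> V y -> dz l (dz k g) y = dz k (dz l g) y.
  by move=> sg Vy; exact: (dz_comm oV k l sg Vy).
have C2 k l g y : smooth_on V g -> V y -> dzbar l (dzbar k g) y = dzbar k (dzbar l g) y.
  by move=> sg Vy; exact: (dzbar_comm oV k l sg Vy).
have C3 k l g y : smooth_on V g -> V y -> dzbar l (dz k g) y = dz k (dzbar l g) y.
  by move=> sg Vy; exact: (dz_dzbar_comm oV k l sg Vy).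
have fhE y k l : V y -> in_chart f c y * h y k l =
    - dz k (fun y => lee_form (@dzbar R n) h y l) y
    - dzbar l (fun y => lee_form_conj (@dz R n) h y k) y.
  move=> Vy; apply: etrans (esym (chern_ricci_sum k l Vy)) _.
  exact: (congr2 +%R (chern_ricci3E oV sh uh k l Vy) (chern_ricci4E oV sh uh k l Vy)).
have Lf y (Vy : V y) := contracted_equation oV d1 d2 C1 C2 C3 sh uh sF fhE
  (fun y i j k l (Vy : V y) => pluriclosed_second oV sh (omega_pluriclosed ac) i j k l Vy) Vy.
have sa := smooth_second_order_coef oV sh uh.
have sX := smooth_first_order_coef oV d2 sh uh.
have sY := smooth_first_order_coef_conj oV d1 sh uh.
move=> Vz0 fle fz0.
(* The reality of [in_chart f c] holds by computation, its values being embedded reals. *)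
exact: (strong_maximum_principle oV sa sX sY second_order_coef_pos sF (fun _ _ => erefl) Lf
  Vz0 fle fz0).
Qed.

End InChart.
End CompactManifold.

Theorem theorem1p5 (R : realType) (n : nat) (hn : (2 <= n)%N)
    (M : complex_manifold R n) (M_compact : compact [set: M])
    (omega : hermitian_metric M)
    (omega_pluriclosed : pluriclosed omega)
    (omega_gauduchon : gauduchon omega)
    (f : M -> R) (f_smooth : smooth_function f)
    (f_curv : forall c : chart R n M, atlas c ->
       form_eq_on (ccod c)
         (form_add (Theta3 omega c) (Theta4 omega c))
         (form_scale (in_chart f c) (fundamental_form omega c))) :
  exists s : R[i], forall (c : chart R n M) (x : M),
    atlas c -> cdom c x -> S_C2 omega c x = s.
Proof.
have f_cst : forall x y, f x = f y.
  apply: constant_of_open_max => //; first exact: smooth_function_continuous.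
  move=> x xmax; have [c ac cx] := atlas_cover x.
  have Vx : ccod c (cmap c x) by exists x.
  have H := in_chart_near_max hn ac f_smooth omega_pluriclosed (f_curv c ac) Vx (m := f x).
  have {}H : \forall z \near cmap c x, complex.Re (in_chart f c z) = f x.
    by apply: H; [move=> z _; exact: xmax|rewrite in_chartK].
  have := cmap_continuous cx H; apply: filterS2 (near_cdom cx) => y cy.
  by rewrite /= cmapK.
(* Connectedness, as defined here, allows the empty space; any constant then does. *)
have [[x0 _]|M0] := pselect (exists x : M, True); last first.
  by exists 0 => c x; case: M0; exists x.
exists (n%:R * (f x0)%:C%C / 2) => c x ac cx.
have Vx : ccod c (cmap c x) by exists x.
rewrite -(f_cst x x0) -(in_chartK f cx).
apply: (chern_scalar2E (metric_unit omega hn ac) Vx) => i j.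
exact: (chern_ricci_sum (f_curv c ac)).
Qed.
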